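(* Let $P_0$ be a probability measure on $\mathbb{R}$ whose moment generating function $M(t)=\int_{-\infty}^{+\infty}e^{tx}P_0(dx)$ is finite for all $t\in\mathbb{R}$, and let $(P_t)_{t\in\mathbb{R}}$ be the natural exponential family generated by $P_0$, $P_t(dx)=\frac{e^{tx}}{M(t)}P_0(dx)$. Let $\alpha\in(0,1)$ and $b\in\mathbb{R}$, and suppose that for every $t\in\mathbb{R}$ the number $b+t$ is an $\alpha$-quantile of $P_t$, that is $$\int_{(-\infty,b+t)}e^{tx}P_0(dx)\leq \alpha M(t)\leq \int_{(-\infty,b+t]}e^{tx}P_0(dx),\qquad t\in\mathbb{R}.$$ Then $P_0=N(m^*,1)$, where $m^*=b-\Phi^{-1}(\alpha)$ and $\Phi$ is the standard Gaussian distribution function; moreover $P_t=N(m^*+t,1)$ for every $t\in\mathbb{R}$.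
   Context: $N(m,1)$ denotes the Gaussian distribution on $\mathbb{R}$ with mean $m$ and variance $1$. $\Phi^{-1}$ is the inverse of the bijection $\Phi:\mathbb{R}\to(0,1)$. *)

(* Defs.v *)
From HB Require Import structures.
From mathcomp Require Import all_boot all_order all_algebra.
From mathcomp Require Import all_classical all_reals all_analysis.
From mathcomp Require Import measurable_realfun.

Set Implicit Arguments.
Unset Strict Implicit.
Unset Printing Implicit Defensive.

Import Order.TTheory GRing.Theory Num.Theory.
Import numFieldNormedType.Exports.

Local Open Scope classical_set_scope.
Local Open Scope ring_scope.

(* Borel probability measures on the line live on [measurableTypeR R], the
   measurable space on which [lebesgue_measure] and [normal_prob] are defined. *)

Definition mgf (R : realType) (P : probability (measurableTypeR R) R) (t : R) :
  \bar R := 'M_P (idfun : measurableTypeR R -> R) t.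

Lemma mgfE (R : realType) (P : probability (measurableTypeR R) R) (t : R) :
  mgf P t = (\int[P]_x (expR (t * x))%:E)%E.
Proof.
rewrite /mgf /mmt_gen_fun unlock.
by under eq_integral do rewrite /= mulrC.
Qed.

(* The normalization uses [fine], so [nef P t] is the intended probability
   measure only when [mgf P t] is finite, see [nef_setT]. *)
Definition nef (R : realType) (P : probability (measurableTypeR R) R) (t : R)
    (A : set (measurableTypeR R)) : \bar R :=
  (\int[P]_(x in A) (expR (t * x) / fine (mgf P t))%:E)%E.

Section nef_measure.
Context (R : realType) (P : probability (measurableTypeR R) R) (t : R).

Lemma mgf_gt0 : (0 < mgf P t)%E.
Proof.
have ge0 (x : measurableTypeR R) : (0 <= (expR (t * x))%:E)%E.
  by rewrite lee_fin expR_ge0.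
rewrite mgfE lt_neqAle integral_ge0// andbT eq_sym; apply/eqP => I0.
have mf : measurable_fun [set: measurableTypeR R]
    (fun x : measurableTypeR R => (expR (t * x))%:E).
  by apply/measurable_EFinP; exact: measurableT_comp.
have /(ae_eq_integral_abs P measurableT mf)[N [mN PN0 sN]] :
    (\int[P]_x `|(expR (t * x))%:E|%E = 0)%E.
  by rewrite -[RHS]I0; apply: eq_integral => x _; rewrite gee0_abs.
have NT : N = setT.
  apply/seteqP; split => // x _; apply: sN => /= /(_ I) [] /eqP.
  by rewrite gt_eqF// expR_gt0.
have := probability_setT P; rewrite -NT => PN1.
by move: PN0 => /=; rewrite PN1 => /eqP; rewrite onee_eq0.
Qed.

Let density_ge0 (x : R) : (0 <= (expR (t * x) / fine (mgf P t))%:E)%E.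
Proof.
by rewrite lee_fin divr_ge0 ?expR_ge0// fine_ge0// mgfE integral_ge0.
Qed.

Let measurable_density (A : set (measurableTypeR R)) :
  measurable_fun A (fun x : measurableTypeR R =>
    (expR (t * x) / fine (mgf P t))%:E).
Proof.
apply/measurable_EFinP/measurable_funTS; apply: measurable_funM => //.
exact: measurableT_comp.
Qed.

Let nef0 : nef P t set0 = 0%E.
Proof. by rewrite /nef integral_set0. Qed.

Let nef_ge0 A : (0 <= nef P t A)%E.
Proof. by apply: integral_ge0 => x _; exact: density_ge0. Qed.

Let nef_semi_sigma_additive : semi_sigma_additive (nef P t).
Proof.
move=> /= A mA tA mUA; rewrite /nef ge0_integral_bigcup//.
by apply: is_cvg_nneseries => n _ _; exact: nef_ge0.
Qed.

HB.instance Definition _ := isMeasure.Build _ _ _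
  (nef P t) nef0 nef_ge0 nef_semi_sigma_additive.

Lemma nef_setT : (mgf P t < +oo)%E -> nef P t setT = 1%E.
Proof.
move=> Mfin; have M0 := mgf_gt0.
have Mnum : mgf P t \is a fin_num by rewrite ge0_fin_numE// ltW.
rewrite /nef; under eq_integral do rewrite mulrC EFinM.
rewrite ge0_integralZl//.
- by rewrite -mgfE -[X in (_ * X)%E]fineK// -EFinM mulVf// gt_eqF// fine_gt0// M0.
- by apply/measurable_EFinP; exact: measurableT_comp.
- by rewrite lee_fin invr_ge0 fine_ge0// ltW.
Qed.

End nef_measure.

Definition std_normal_cdf (R : realType) (x : R) : R :=
  fine (normal_prob 0 1 `]-oo, x]).

Section std_normal_cdf_bij.
Context (R : realType).

Let Phi := @std_normal_cdf R.

Let derivable_Phi (x : R) :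
  derivable Phi x 1 /\ derive1 Phi x = normal_pdf 0 1 x.
Proof.
apply: (@continuous_FTC1 R (normal_pdf 0 1) -oo%O x (x + 1)).
- by rewrite ltrDl.
- exact: integrableS (integrable_normal_pdf 0 1).
- exact: ltNyr.
- exact: continuous_normal_pdf.
Qed.

Let continuous_Phi : continuous Phi.
Proof.
move=> x; apply/differentiable_continuous/derivable1_diffP.
exact: (derivable_Phi x).1.
Qed.

Let Phi_lt (x y : R) : x < y -> Phi x < Phi y.
Proof.
move=> xy; apply: (@gtr0_derive1_lt_cc _ Phi x y);
  rewrite ?in_itv/= ?lexx ?(ltW xy)//.
- by move=> z _; exact: (derivable_Phi z).1.
- move=> z _; rewrite (derivable_Phi z).2 normal_pdfE//.
  by rewrite mulr_gt0 ?normal_peak_gt0 ?expR_gt0.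
- exact: continuous_subspaceT.
Qed.

Let id_meas : measurableTypeR R -> R := idfun.

#[local] HB.instance Definition _ :=
  @isMeasurableFun.Build _ _ _ _ id_meas (@measurable_id _ _ setT).

Let X : {RV (normal_prob 0 1 : probability _ R) >-> R} := id_meas.

Let Phi_cdf : Phi = fine \o cdf X.
Proof. by []. Qed.

Let Phi_itv (x : R) : Phi x \in `]0, 1[.
Proof.
have Phi01 z : 0 <= Phi z <= 1.
  have fin : cdf X z \is a fin_num by exact: fin_num_measure.
  rewrite Phi_cdf; apply/andP; split; first exact: fine_ge0 (cdf_ge0 X z).
  by rewrite -lee_fin /= fineK// cdf_le1.
rewrite in_itv/=; apply/andP; split.
- by apply: le_lt_trans (@Phi_lt (x - 1) x _); [case/andP: (Phi01 (x - 1))|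
    rewrite ltrBlDr ltrDl].
- by apply: lt_le_trans (@Phi_lt x (x + 1) _) _; [rewrite ltrDl|
    case/andP: (Phi01 (x + 1))].
Qed.

Lemma std_normal_cdf_bij : set_bij [set: R] `]0, 1[ (@std_normal_cdf R).
Proof.
split=> [x _|x y _ _ xy|p].
- exact: Phi_itv.
- by case: (ltgtP x y) => // /Phi_lt; rewrite /Phi xy ltxx.
- rewrite /= in_itv/= => /andP[p0 p1].
  have [a Pa] : exists a, Phi a < p.
    have /fine_cvg/cvgr_lt/(_ _ p0) := cvg_cdfNy0 X.
    exact: filter_ex.
  have [b Pb] : exists b, p < Phi b.
    have /fine_cvg/cvgr_gt/(_ _ p1) := cvg_cdfy1 X.
    exact: filter_ex.
  have ab : a <= b.
    by rewrite leNgt; apply/negP => /Phi_lt/(lt_trans Pb)/(lt_trans Pa);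
      rewrite ltxx.
  have [||c _ Pc] := @IVT _ Phi a b p ab.
  + exact: continuous_subspaceT.
  + by rewrite ge_min le_max (ltW Pa) (ltW Pb) orbT.
  + by exists c.
Qed.

End std_normal_cdf_bij.

Definition std_normal_quantile (R : realType) : R -> R :=
  'pinv_(fun=> 0) [set: R] (@std_normal_cdf R).

Lemma std_normal_quantileK (R : realType) (p : R) :
  0 < p < 1 -> std_normal_cdf (std_normal_quantile p) = p.
Proof.
have [_ _ surj] := @std_normal_cdf_bij R.
by move=> p01; apply: pinvK; rewrite inE; apply: surj; rewrite /= in_itv.
Qed.

(* Main.v *)
(* Let c be the alpha-quantile of N(0, 1), m = b - c, and let phi and phi_m be
   the densities of N(0, 1) and N(m, 1). Put Q(dx) = P0(dx) / phi_m(x) and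
   g(y) = phi(c - y). Since g(u - x) / phi_m(x) is e^((u - b) x) up to a factor
   depending on u only, the quantile condition says that
     int_(x < u) g(u - x) Q(dx) <= alpha int g(u - x) Q(dx)
                                <= int_(x <= u) g(u - x) Q(dx).
   Integrating in u, the convolution of Q with
   K(y) = int_(z > y) (1_(z > 0) - alpha) g(z) dz >= 0 is constant, so that Q is
   bounded on windows of fixed length. Differentiating twice instead gives
   g(0) Q = Q * nu with nu(y) = (max(y, 0) - alpha y) g(y) >= 0, of mass g(0).
   By a Choquet-Deny argument Q(u + W) does not depend on u for windows W, so Q
   is a multiple of the Lebesgue measure and P0 has density proportional to
   phi_m. The atoms of Q are handled by squeezing a smoothed window mass
   between the masses of the open and of the closed window. *)

Require Import Defs.
From mathcomp Require Import all_boot all_order all_algebra.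
From mathcomp Require Import all_classical all_reals all_analysis.
From mathcomp Require Import measurable_realfun ring lra.

Set Implicit Arguments.
Unset Strict Implicit.
Unset Printing Implicit Defensive.

Import Order.TTheory GRing.Theory Num.Theory.
Import numFieldNormedType.Exports.

Local Open Scope classical_set_scope.
Local Open Scope ring_scope.

(** * Normal distribution *)

Section std_normal_cdf_theory.
Context {R : realType}.
Implicit Types (x y z a : R).
Local Notation mu := (@lebesgue_measure R).
Local Notation phi := (@normal_pdf R 0 1).
Local Notation Phi := (@std_normal_cdf R).

Lemma normal_pdf1E m x :
  normal_pdf m 1 x = normal_peak 1 * expR (- (x - m) ^+ 2 / 2).
Proof. by rewrite normal_pdfE// /normal_fun expr1n. Qed.

Lemma normal_pdf1_gt0 m x : 0 < normal_pdf m 1 x.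
Proof. by rewrite normal_pdf1E mulr_gt0 ?expR_gt0 ?normal_peak_gt0. Qed.

Lemma EFin_std_normal_cdf x :
  ((Phi x)%:E = \int[mu]_(z in `]-oo, x]) (phi z)%:E)%E.
Proof. by rewrite fineK// (@fin_num_measure _ _ _ (normal_prob 0 1)). Qed.

Lemma EFin_std_normal_cdfC x :
  ((1 - Phi x)%:E = \int[mu]_(z in `]x, +oo[) (phi z)%:E)%E.
Proof.
have := @probability_setC _ _ _ (@normal_prob R 0 1) `]-oo, x] (measurable_itv _).
by rewrite setCitvl EFinB EFin_std_normal_cdf => /esym.
Qed.

Global Instance is_derive_std_normal_cdf x : is_derive x 1 Phi (phi x).
Proof.
have [dP <-] : derivable Phi x 1 /\ derive1 Phi x = phi x.
  apply: (@continuous_FTC1 R phi -oo%O x (x + 1)).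
  - by rewrite ltrDl.
  - exact: integrableS (integrable_normal_pdf 0 1).
  - exact: ltNyr.
  - exact: continuous_normal_pdf.
by rewrite derive1E; exact: derivableP.
Qed.

Lemma std_normal_cdf_itv x : 0 < Phi x < 1.
Proof. by have [/(_ x I)] := @std_normal_cdf_bij R; rewrite /= in_itv. Qed.

Lemma std_normal_cdf_le x y : x <= y -> Phi x <= Phi y.
Proof.
move=> xy; rewrite -lee_fin !EFin_std_normal_cdf.
apply: ge0_subset_integral => //.
- by apply/measurable_funTS/measurable_EFinP; exact: measurable_normal_pdf.
- by move=> z _; rewrite lee_fin normal_pdf_ge0.
- by apply: subset_itvl; rewrite bnd_simp.
Qed.

Global Instance is_derive_std_normal_pdf x :
  is_derive x 1 phi (- x * phi x).
Proof.
have -> : phi = (fun z => normal_peak 1 * expR (- z ^+ 2 / 2)).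
  by apply/funext => z; rewrite normal_pdf1E subr0.
have de : is_derive x 1 (fun z => expR (- z ^+ 2 / 2)) (expR (- x ^+ 2 / 2) * - x).
  apply: (@is_derive1_comp _ expR (fun z => - z ^+ 2 / 2)).
  by apply: is_derive_eq; rewrite /GRing.scale/=; field.
by apply: is_derive_eq; rewrite /GRing.scale/=; ring.
Qed.

(* On a half-line pointing away from the origin [phi] is dominated by the
   density of N(a, 1) scaled by [expR (- a ^+ 2 / 2)]. *)
Lemma std_normal_pdf_le_shift a z : 0 <= a * (z - a) ->
  phi z <= expR (- a ^+ 2 / 2) * normal_pdf a 1 z.
Proof.
move=> az; rewrite !normal_pdf1E subr0 mulrCA ler_pM2l ?normal_peak_gt0//.
rewrite -expRD ler_expR; nra.
Qed.

(** The pointwise domination is integrated over [D], on which N(a, 1) has mass at most 1. Left tails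
    correspond to [a <= 0], right tails to [a >= 0]. *)
Lemma std_normal_tail_le a (D : set R) : measurable D ->
  (forall z, D z -> 0 <= a * (z - a)) ->
  (\int[mu]_(z in D) (phi z)%:E <= (expR (- a ^+ 2 / 2))%:E)%E.
Proof.
move=> mD Da.
apply: (@le_trans _ _
  (\int[mu]_(z in D) ((expR (- a ^+ 2 / 2))%:E * (normal_pdf a 1 z)%:E))%E).
  apply: ge0_le_integral => //=.
  - by move=> z _; rewrite lee_fin normal_pdf_ge0.
  - by apply/measurable_funTS/measurable_EFinP; exact: measurable_normal_pdf.
  - apply/measurable_funTS/measurable_EFinP; apply: measurable_funM => //.
    exact: measurable_normal_pdf.
  - by move=> z Dz; rewrite -EFinM lee_fin std_normal_pdf_le_shift// Da.
rewrite ge0_integralZl//=; first last.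
- by move=> z _; rewrite lee_fin normal_pdf_ge0.
- by apply/measurable_funTS/measurable_EFinP; exact: measurable_normal_pdf.
rewrite -[leRHS]mule1 lee_wpmul2l ?lee_fin ?expR_ge0//.
exact: (@probability_le1 _ _ _ (normal_prob a 1)).
Qed.

(** For [a <= 0] this is the tail bound weakened by a factor at least 1; for [0 < a] the hypothesis
    makes the right-hand side at least 1. *)
Lemma std_normal_cdf_le_expR c a : a <= `|c| ->
  Phi a <= expR (c ^+ 2 / 2) * expR (- a ^+ 2 / 2).
Proof.
move=> ac; have [a0|a0] := leP a 0.
  rewrite -[leLHS]mul1r ler_pM//.
  - by case/andP: (std_normal_cdf_itv a) => /ltW.
  - by rewrite -[leLHS]expR0 ler_expR divr_ge0// sqr_ge0.
  - rewrite -lee_fin EFin_std_normal_cdf; apply: std_normal_tail_le => //.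
    by move=> z; rewrite /= in_itv/= => za; nra.
rewrite -expRD; apply: (@le_trans _ _ 1).
  by case/andP: (std_normal_cdf_itv a) => _ /ltW.
rewrite -[leLHS]expR0 ler_expR -(real_normK (num_real c)).
have : a ^+ 2 <= `|c| ^+ 2 by rewrite lerXn2r// nnegrE// ltW.
lra.
Qed.

Lemma std_normal_cdfC_le_expR c a : - a <= `|c| ->
  1 - Phi a <= expR (c ^+ 2 / 2) * expR (- a ^+ 2 / 2).
Proof.
move=> ac; have [a0|a0] := leP 0 a.
  rewrite -[leLHS]mul1r ler_pM//.
  - by rewrite subr_ge0; case/andP: (std_normal_cdf_itv a) => _ /ltW.
  - by rewrite -[leLHS]expR0 ler_expR divr_ge0// sqr_ge0.
  - rewrite -lee_fin EFin_std_normal_cdfC; apply: std_normal_tail_le => //.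
    by move=> z; rewrite /= in_itv/= andbT => za; nra.
rewrite -expRD; apply: (@le_trans _ _ 1).
  by rewrite gerBl; case/andP: (std_normal_cdf_itv a) => /ltW.
rewrite -[leLHS]expR0 ler_expR -(real_normK (num_real c)) -(sqrrN a).
have : (- a) ^+ 2 <= `|c| ^+ 2.
  by rewrite lerXn2r// nnegrE// ltW// oppr_gt0.
lra.
Qed.

End std_normal_cdf_theory.

(** * Lebesgue integrals *)

Lemma measurable_natrb {R : realType} d (T : measurableType d) (D : set T)
    (g : T -> bool) :
  measurable_fun D g -> measurable_fun D (fun x => (g x)%:R : R).
Proof.
move=> mg.
exact: (@measurable_comp _ _ _ _ _ _ setT (fun b : bool => b%:R : R)).
Qed.

Section lebesgue_integral_facts.
Context {R : realType}.
Local Notation mu := (@lebesgue_measure R).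

(** Translation by [a] transports the Lebesgue measure to a measure with the same values on
    half-open intervals, hence to itself. *)
Lemma ge0_integral_shift (f : R -> R) (a : R) :
  measurable_fun [set: R] f -> (forall x, 0 <= f x) ->
  (\int[mu]_x (f (x + a))%:E = \int[mu]_x (f x)%:E)%E.
Proof.
move=> mf f0.
have ma : measurable_fun [set: measurableTypeR R]
    (fun x : measurableTypeR R => (x + a : measurableTypeR R)).
  exact: measurable_funD.
pose nu := pushforward mu (fun x : measurableTypeR R => (x + a : measurableTypeR R)).
have nuE A : measurable A -> mu A = nu A.
  apply: lebesgue_measure_unique => X [[r s]/= _ <-].
  rewrite /nu /pushforward.
  rewrite [X in _ = mu X](_ : _ = `]r - a, s - a]%classic); last first.
    by apply/seteqP; split => x /=; rewrite !in_itv/= ltrBlDr lerBrDr.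
  rewrite !lebesgue_measure_itv/= !lte_fin ltrD2r; case: ifP => // _.
  by rewrite -!EFinB; congr EFin; lra.
rewrite [RHS](eq_measure_integral nu) => [|A mA _]; last exact: nuE.
rewrite ge0_integral_pushforward//=.
- exact/measurable_EFinP.
- by move=> x _; rewrite lee_fin.
Qed.

Lemma is_derive_continuous (F f : R -> R) :
  (forall y : R, is_derive y 1 F (f y)) -> continuous F.
Proof.
by move=> dF y; apply/differentiable_continuous/derivable1_diffP/ex_derive.
Qed.

Lemma continuous_comp_subr (f : R -> R) (a : R) :
  continuous f -> continuous (fun x : R => f (x - a)).
Proof.
move=> cf u; apply: (@cvg_comp _ _ _ (fun u : R => u - a) f); last exact: cf.
by apply: cvgB; [exact: cvg_id|exact: cvg_cst].
Qed.

Lemma is_derive_comp_subr (F f : R -> R) (a : R) :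
  (forall y : R, is_derive y 1 F (f y)) ->
  forall y : R, is_derive y 1 (fun x => F (x - a)) (f (y - a)).
Proof. by move=> dF y; apply: is_derive_eq; rewrite subr0 mulr1. Qed.

Lemma integral_oc (F f : R -> R) (r s : R) :
  (forall y : R, is_derive y 1 F (f y)) -> continuous f -> r <= s ->
  (\int[mu]_(u in `]r, s]) (f u)%:E = (F s - F r)%:E)%E.
Proof.
move=> dF cf; rewrite le_eqVlt => /predU1P[->|rs].
  by rewrite set_itvoc0 integral_set0 subrr.
rewrite integral_itv_obnd_cbnd; last first.
  by apply/measurable_EFinP/measurable_funTS; exact: continuous_measurable_fun.
have cF := is_derive_continuous dF.
rewrite (@continuous_FTC2 _ _ F)//.
- exact: continuous_subspaceT.
- split.
  + by move=> y _; apply: ex_derive.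
  + by apply: cvg_at_right_filter; exact: cF.
  + by apply: cvg_at_left_filter; exact: cF.
- by move=> y _; rewrite derive1E; apply: derive_val.
Qed.

(** The indicator trims the interval to []Num.max r x, Num.max s x]], which is empty when
    [s <= x]. *)
Lemma integral_oc_step (F f : R -> R) (x r s : R) :
  (forall y : R, is_derive y 1 F (f y)) -> continuous f -> r <= s ->
  (\int[mu]_(u in `]r, s]) ((x < u)%R%:R * f (u - x))%:E =
   (F (Num.max s x - x) - F (Num.max r x - x))%:E)%E.
Proof.
move=> dF cf rs; have cfx := @continuous_comp_subr f x cf.
transitivity (\int[mu]_(u in `]Num.max r x, Num.max s x]) (f (u - x))%:E)%E.
  have -> : `]Num.max r x, Num.max s x]%classic = `]r, s] `&` `]x, +oo[.
    apply/seteqP; split => u /=; rewrite !in_itv/= gt_max le_max.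
      by case/andP => /andP[-> xu]; rewrite xu (lt_geF xu) orbF => ->.
    by case=> /andP[-> ->]; rewrite andbT => ->.
  rewrite integral_mkcondr; apply: eq_integral => u _.
  rewrite patchE; have [xu|xu] := boolP (x < u).
    by rewrite mem_set ?mul1r//= in_itv/= xu.
  by rewrite memNset ?mul0r//= in_itv/= (negbTE xu).
apply: (@integral_oc (fun u => F (u - x))) => //.
  exact: is_derive_comp_subr.
by rewrite ge_max !le_max rs lexx orbT.
Qed.

Lemma integral_oc_stepN (F f : R -> R) (x r s : R) :
  (forall y : R, is_derive y 1 F (f y)) -> continuous f -> r <= s ->
  (\int[mu]_(u in `]r, s]) ((u <= x)%R%:R * f (u - x))%:E =
   (F (Num.min s x - x) - F (Num.min r x - x))%:E)%E.
Proof.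
move=> dF cf rs; have cfx := @continuous_comp_subr f x cf.
transitivity (\int[mu]_(u in `]Num.min r x, Num.min s x]) (f (u - x))%:E)%E.
  have -> : `]Num.min r x, Num.min s x]%classic = `]r, s] `&` `]-oo, x].
    apply/seteqP; split => u /=; rewrite !in_itv/= gt_min le_min.
      by case/andP => + /andP[-> ux]; rewrite (ltNge x) ux orbF => ->.
    by case=> /andP[-> ->] ->.
  rewrite integral_mkcondr; apply: eq_integral => u _.
  rewrite patchE; have [ux|ux] := boolP (u <= x).
    by rewrite mem_set ?mul1r//= in_itv/= ux.
  by rewrite memNset ?mul0r//= in_itv/= (negbTE ux).
apply: (@integral_oc (fun u => F (u - x))) => //.
  exact: is_derive_comp_subr.
by rewrite le_min !ge_min rs lexx orbT.
Qed.

(** The indicators of [x <= u] and [x < u] differ only at the Lebesgue-null point [u = x]. This is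
    why both quantile inequalities integrate to the same quantity. *)
Lemma integral_oc_cstep (F f : R -> R) (x r s : R) :
  (forall y : R, is_derive y 1 F (f y)) -> continuous f -> r <= s ->
  (\int[mu]_(u in `]r, s]) ((x <= u)%R%:R * f (u - x))%:E =
   (F (Num.max s x - x) - F (Num.max r x - x))%:E)%E.
Proof.
move=> dF cf rs; rewrite -(@integral_oc_step F f)//.
have cfx := @continuous_comp_subr f x cf.
have mB (g : R -> bool) : measurable_fun [set: R] g ->
    measurable_fun `]r, s] (fun u => ((g u)%:R * f (u - x))%:E).
  move=> mg; apply/measurable_funTS/measurable_EFinP/measurable_funM.
    exact: measurable_natrb.
  exact: continuous_measurable_fun.
have mD : measurable (`]r, s] `\ x) by exact: measurableD.
rewrite -[LHS](@integral_setD1 _ _ x)//; last first.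
  apply: measurable_funS (mB (fun u => x <= u) _) => //.
  exact: measurable_fun_ler.
rewrite -[RHS](@integral_setD1 _ _ x)//; last first.
  apply: measurable_funS (mB (fun u => x < u) _) => //.
  exact: measurable_fun_ltr.
apply: eq_integral => u; rewrite inE => -[_ /= /eqP ux].
by rewrite le_eqVlt eq_sym (negbTE ux).
Qed.

End lebesgue_integral_facts.

(** * A Liouville theorem for convolution equations *)

Section convolution_harmonic.
Context {R : realType}.
Local Notation mu := (@lebesgue_measure R).

Lemma measurable_convol_integrand (rho g : R -> R) (x : R) :
  measurable_fun [set: R] rho -> measurable_fun [set: R] g ->
  measurable_fun [set: R] (fun y : R => rho y * g (x - y)).
Proof.
move=> mrho mg; apply: measurable_funM => //.
by apply: measurableT_comp => //; exact: measurable_funB.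
Qed.

(* Averaging the harmonic function [S - (g x - g (x - a))] over the [N]
   windows [`[1, 2] + i * a] makes the increments of [g] telescope, so that it
   stays away from [0]; hence the supremum [S] of the increments is not
   positive. *)
Lemma convol_harmonic_le (rho g : R -> R) (B a : R) :
  measurable_fun [set: R] rho -> (forall y, 0 <= rho y) ->
  (\int[mu]_y (rho y)%:E = 1)%E ->
  (forall M, exists2 k, 0 < k & forall y, 1 <= y <= M -> k <= rho y) ->
  measurable_fun [set: R] g -> (forall x, 0 <= g x <= B) ->
  (forall x, (\int[mu]_y (rho y * g (x - y))%:E = (g x)%:E)%E) ->
  0 <= a -> forall x, g x <= g (x - a).
Proof.
move=> mrho rho0 rho1 rhok mg gB gh a0 x0; rewrite leNgt; apply/negP => gx0.
pose D x := g x - g (x - a).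
pose S := sup (range D).
have hsD : has_sup (range D).
  split; first by exists (D x0), x0.
  exists B => _ [x _ <-]; rewrite /D.
  by have := gB x; have := gB (x - a); lra.
have DS x : D x <= S by apply: ub_le_sup; [exact: hsD.2|exists x].
have S0 : 0 < S by apply: lt_le_trans (DS x0); rewrite subr_gt0.
pose f x := S + g (x - a) - g x.
have f0 x : 0 <= f x by have := DS x; rewrite /D /f; lra.
have mf : measurable_fun [set: R] f.
  apply: measurable_funB => //; apply: measurable_funD => //.
  by apply: measurableT_comp => //; exact: measurable_funB.
(* Constants are harmonic because [rho] has mass 1, and so are translates of [g]. The integral of
   [rho y * g (x - y)] is added and subtracted so that all integrands stay nonnegative. *)
have fh x : (\int[mu]_y (rho y * f (x - y))%:E = (f x)%:E)%E.
  have gfin : (\int[mu]_y (rho y * g (x - y))%:E)%E \is a fin_num by rewrite gh.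
  rewrite -[LHS](addeK _ gfin) -ge0_integralD//=; first last.
  - by apply/measurable_EFinP; exact: measurable_convol_integrand.
  - by move=> y _; rewrite lee_fin mulr_ge0//; case/andP: (gB (x - y)).
  - by apply/measurable_EFinP; exact: measurable_convol_integrand.
  - by move=> y _; rewrite lee_fin mulr_ge0.
  rewrite [X in (X - _)%E](_ : _ =
      (\int[mu]_y (S%:E * (rho y)%:E + (rho y * g (x - a - y))%:E))%E); last first.
    apply: eq_integral => y _; rewrite -EFinM -!EFinD /f; congr EFin.
    by rewrite (_ : x - a - y = x - y - a); [ring|ring].
  rewrite ge0_integralD//=; first last.
  - by apply/measurable_EFinP; exact: measurable_convol_integrand.
  - by move=> y _; rewrite lee_fin mulr_ge0//; case/andP: (gB (x - a - y)).
  - by apply/measurable_EFinP; exact: measurable_funM.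
  - by move=> y _; rewrite lee_fin mulr_ge0// ltW.
  rewrite ge0_integralZl//=; first last.
  - by rewrite lee_fin ltW.
  - by move=> y _; rewrite lee_fin.
  - exact/measurable_EFinP.
  by rewrite rho1 mule1 !gh -!EFinD /f; congr EFin; ring.
(* Since [g] has values between 0 and [B], this [N] makes the telescoped sum
   [S * N%:R + g (w - N%:R * a) - g w] at least 1. *)
have [N BN] : exists N, B + 1 <= S * N%:R.
  exists (Num.bound ((B + 1) / S)); rewrite mulrC -ler_pdivrMr//.
  apply/ltW/archi_boundP; rewrite divr_ge0 ?(ltW S0)//.
  by have := gB 0; lra.
have N0 : 0 < N%:R :> R.
  rewrite -(pmulr_rgt0 _ S0); apply: lt_le_trans BN.
  by have := gB 0; lra.
(* One bound [k] serves all windows [[1, 2] + i * a] with [i < N]. *)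
have [k k0 rk] := rhok (2 + N%:R * a).
have sumf w n : \sum_(i < n) f (w - i%:R * a) = S * n%:R + g (w - n%:R * a) - g w.
  elim: n => [|n IH]; first by rewrite big_ord0 mul0r subr0; ring.
  rewrite big_ord_recr/= IH /f -natr1.
  by rewrite (_ : w - n%:R * a - a = w - (n%:R + 1) * a); ring.
have fk x : k / N%:R <= f x.
  rewrite ler_pdivrMr// -lee_fin.
  have -> : (f x * N%:R)%:E = (\sum_(i < N) (f x)%:E)%E.
    by rewrite sumEFin sumr_const card_ord mulr_natr.
  apply: (@le_trans _ _
      (\sum_(i < N) \int[mu]_(z in `[1%R, 2%R]) (k * f (x - z - i%:R * a))%:E)%E).
    rewrite -ge0_integral_sum//=; first last.
    - by move=> i z _; rewrite lee_fin mulr_ge0// ltW.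
    - move=> i; apply/measurable_funTS/measurable_EFinP/measurable_funM => //.
      apply: measurableT_comp => //; apply: measurable_funB => //.
      exact: measurable_funB.
    apply: (@le_trans _ _ (\int[mu]_(z in `[1%R, 2%R]) (cst k%:E z))%E).
      rewrite integral_cst//= lebesgue_measure_itv/= lte_fin ltr1n -EFinB.
      by rewrite -EFinM lee_fin (_ : 2 - 1 = 1 :> R) ?mulr1//; ring.
    apply: ge0_le_integral => //=.
    - by move=> z _; rewrite lee_fin ltW.
    - apply/measurable_funTS; apply: emeasurable_sum => i.
      apply/measurable_EFinP/measurable_funM => //.
      apply: measurableT_comp => //; apply: measurable_funB => //.
      exact: measurable_funB.
    - move=> z _; rewrite sumEFin lee_fin -mulr_sumr ler_peMr ?(ltW k0)// sumf.
      by have := gB (x - z - N%:R * a); have := gB (x - z); lra.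
  (* Each copy of [f x] is rewritten by harmonicity, translated by [i%:R * a] and restricted to
     [[1, 2]], where the translated [rho] is at least [k]. *)
  apply: lee_sum => i _.
  rewrite -fh -(@ge0_integral_shift _ (fun y => rho y * f (x - y)) (i%:R * a)).
  - apply: (@le_trans _ _ (\int[mu]_(z in `[1%R, 2%R])
        (rho (z + i%:R * a) * f (x - (z + i%:R * a)))%:E)%E); last first.
      apply: ge0_subset_integral => //=.
      + apply/measurable_EFinP/measurable_funM.
          by apply: measurableT_comp => //; exact: measurable_funD.
        apply: measurableT_comp => //; apply: measurable_funB => //.
        exact: measurable_funD.
      + by move=> z _; rewrite lee_fin mulr_ge0.
    apply: ge0_le_integral => //=.
    + by move=> z _; rewrite lee_fin mulr_ge0// ltW.
    + apply/measurable_funTS/measurable_EFinP/measurable_funM => //.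
      apply: measurableT_comp => //; apply: measurable_funB => //.
      exact: measurable_funB.
    + apply/measurable_funTS/measurable_EFinP/measurable_funM.
        by apply: measurableT_comp => //; exact: measurable_funD.
      apply: measurableT_comp => //; apply: measurable_funB => //.
      exact: measurable_funD.
    + move=> z; rewrite in_itv/= => /andP[z1 z2].
      rewrite lee_fin opprD addrA ler_wpM2r// rk//.
      have ia : 0 <= i%:R * a <= N%:R * a.
        by rewrite mulr_ge0//= ler_wpM2r// ler_nat ltnW.
      by lra.
  - exact: measurable_convol_integrand.
  - by move=> y; rewrite mulr_ge0.
have kN0 : 0 < k / N%:R by rewrite divr_gt0.
(* As [f x = S - D x], the uniform lower bound on [f] gives an upper bound of the range of [D] below
   its supremum. *)
suff : S <= S - k / N%:R by lra.
apply: ge_sup; first by exists (D x0), x0.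
by move=> _ [x _ <-]; have := fk x; rewrite /D /f; lra.
Qed.

(** The function [B - g] satisfies the same hypotheses as [g], so both are nonincreasing. *)
Lemma convol_harmonic_cst (rho g : R -> R) (B : R) :
  measurable_fun [set: R] rho -> (forall y, 0 <= rho y) ->
  (\int[mu]_y (rho y)%:E = 1)%E ->
  (forall M, exists2 k, 0 < k & forall y, 1 <= y <= M -> k <= rho y) ->
  measurable_fun [set: R] g -> (forall x, 0 <= g x <= B) ->
  (forall x, (\int[mu]_y (rho y * g (x - y))%:E = (g x)%:E)%E) ->
  forall x y, g x = g y.
Proof.
move=> mrho rho0 rho1 rhok mg gB gh.
suff main x y : y <= x -> g x = g y.
  by move=> x y; have [/main|/ltW/main] := leP y x.
move=> yx; have a0 : 0 <= x - y by rewrite subr_ge0.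
have xyE : x - (x - y) = y by ring.
apply/eqP; rewrite eq_le; apply/andP; split.
  by have := convol_harmonic_le mrho rho0 rho1 rhok mg gB gh a0 x; rewrite xyE.
pose h x := B - g x.
have mh : measurable_fun [set: R] h by exact: measurable_funB.
have hB z : 0 <= h z <= B by have := gB z; rewrite /h; lra.
have hh z : (\int[mu]_w (rho w * h (z - w))%:E = (h z)%:E)%E.
  have gfin : (\int[mu]_w (rho w * g (z - w))%:E)%E \is a fin_num by rewrite gh.
  rewrite -[LHS](addeK _ gfin) -ge0_integralD//=; first last.
  - by apply/measurable_EFinP; exact: measurable_convol_integrand.
  - by move=> w _; rewrite lee_fin mulr_ge0//; case/andP: (gB (z - w)).
  - by apply/measurable_EFinP; exact: measurable_convol_integrand.
  - by move=> w _; rewrite lee_fin mulr_ge0//; case/andP: (hB (z - w)).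
  have B0 : 0 <= B by have := gB 0; lra.
  rewrite [X in (X - _)%E](_ : _ = (\int[mu]_w (B%:E * (rho w)%:E))%E); last first.
    by apply: eq_integral => w _; rewrite -EFinM -EFinD /h; congr EFin; ring.
  rewrite ge0_integralZl//=; first last.
  - by move=> w _; rewrite lee_fin.
  - exact/measurable_EFinP.
  by rewrite rho1 mule1 gh -EFinD /h; congr EFin; ring.
have := convol_harmonic_le mrho rho0 rho1 rhok mh hB hh a0 x.
by rewrite xyE /h; lra.
Qed.

End convolution_harmonic.

(** Cauchy's functional equation on the half-line: nonnegativity and additivity give monotonicity,
    and comparing [n%:R * t] with the neighbouring integers leaves an error of at most
    [C 1 / n%:R]. *)
Lemma additive_ge0_linear {R : realType} (C : R -> R) :
  (forall s t, 0 <= s -> 0 <= t -> C (s + t) = C s + C t) ->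
  (forall s, 0 <= s -> 0 <= C s) ->
  forall t, 0 <= t -> C t = C 1 * t.
Proof.
move=> CD C0.
have Cle s t : 0 <= s <= t -> C s <= C t.
  move=> /andP[s0 st]; have -> : t = s + (t - s) by ring.
  by rewrite CD ?subr_ge0// lerDl C0// subr_ge0.
have Cn n t : 0 <= t -> C (n%:R * t) = n%:R * C t.
  move=> t0; elim: n => [|n IH].
    by have := CD 0 0 (lexx _) (lexx _); rewrite !mul0r addr0; lra.
  by rewrite -natr1 mulrDl mul1r CD ?mulr_ge0// IH; ring.
have C1 := C0 1 ler01.
move=> t t0; apply/eqP; rewrite -subr_eq0 -normr_le0; apply/ler_addgt0Pl => e e0.
rewrite addr0.
pose n := (Num.bound (C 1 / e)).+1.
have n0 : 0 < n%:R :> R by rewrite ltr0n.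
have nE : C 1 <= e * n%:R.
  rewrite mulrC -ler_pdivrMr// ltW// (lt_trans (archi_boundP _)) ?divr_ge0 ?(ltW e0)//.
  by rewrite ltr_nat.
have nt0 : 0 <= n%:R * t by rewrite mulr_ge0// ltW.
have [k /andP[k1 k2]] : exists k : nat, k%:R <= n%:R * t < k%:R + 1.
  by exists (Num.truncn (n%:R * t)); rewrite natr1; exact: truncn_itv.
have Ck j : C j%:R = j%:R * C 1 by rewrite -[in LHS](mulr1 j%:R) Cn.
have L : k%:R * C 1 <= n%:R * C t <= (k%:R + 1) * C 1.
  rewrite -(Cn _ t t0) natr1 -!Ck; apply/andP; split; apply: Cle.
    by rewrite k1 ler0n.
  by rewrite nt0 -natr1 ltW.
rewrite -(ler_pM2l n0) -{1}(gtr0_norm n0) -normrM ler_norml.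
by apply/andP; split; nra.
Qed.

(** * Weighted integrals *)

Section weighted_integral.
Context {R : realType} (P : probability (measurableTypeR R) R) (q : R -> R).
Hypotheses (mq : measurable_fun [set: R] q) (q_ge0 : forall x, 0 <= q x).
Local Notation mu := (@lebesgue_measure R).
Implicit Types f g : R -> R.

(** Integration against the measure Q with density [q] with respect to [P]. Q may have infinite
    mass, so products are integrated against the probability [P] instead. *)
Definition wintegrable f :=
  P.-integrable [set: measurableTypeR R] (fun x => (q x * f x)%:E).

(** The real-valued integral is the intended one only when [f] is [wintegrable], see [EFin_wint]. *)
Definition wint f : R := \int[P]_x (q x * f x).

Lemma EFin_wint f : wintegrable f ->
  ((wint f)%:E = \int[P]_x (q x * f x)%:E)%E.
Proof. by move=> ?; rewrite fineK//; exact: integrable_fin_num. Qed.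

Lemma ge0_wintegrable f : measurable_fun [set: R] f -> (forall x, 0 <= f x) ->
  (\int[P]_x (q x * f x)%:E < +oo)%E -> wintegrable f.
Proof.
move=> mf f0 foo; apply/integrableP; split.
  by apply/measurable_EFinP; exact: measurable_funM.
by under eq_integral do rewrite gee0_abs ?lee_fin ?mulr_ge0//.
Qed.

Lemma le_wintegrable f g : measurable_fun [set: R] f ->
  (forall x, `|f x| <= g x) -> wintegrable g -> wintegrable f.
Proof.
move=> mf fg; apply: le_integrable => //.
  by apply/measurable_EFinP; exact: measurable_funM.
move=> x _; rewrite lee_fin !normrM ler_wpM2l//.
exact: le_trans (fg x) (ler_norm _).
Qed.

Lemma wintegrableZ k f : wintegrable f -> wintegrable (fun x => k * f x).
Proof.
move=> /(integrableZl measurableT k); apply: eq_integrable => // x _.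
by rewrite -EFinM mulrCA.
Qed.

Lemma wintegrableD f g : wintegrable f -> wintegrable g ->
  wintegrable (fun x => f x + g x).
Proof.
move=> fi gi; apply: eq_integrable (integrableD measurableT fi gi) => // x _.
by rewrite /= mulrDr EFinD.
Qed.

Lemma wintegrableB f g : wintegrable f -> wintegrable g ->
  wintegrable (fun x => f x - g x).
Proof.
move=> fi gi; apply: eq_integrable (integrableB measurableT fi gi) => // x _.
by rewrite /= mulrBr EFinB.
Qed.

Lemma wintZ k f : wintegrable f -> wint (fun x => k * f x) = k * wint f.
Proof.
by move=> fi; rewrite /wint -RintegralZl//; apply: eq_Rintegral => x _; rewrite mulrCA.
Qed.

Lemma wintD f g : wintegrable f -> wintegrable g ->
  wint (fun x => f x + g x) = wint f + wint g.
Proof.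
by move=> fi gi; rewrite /wint -RintegralD//; apply: eq_Rintegral => x _; rewrite mulrDr.
Qed.

Lemma wintB f g : wintegrable f -> wintegrable g ->
  wint (fun x => f x - g x) = wint f - wint g.
Proof.
by move=> fi gi; rewrite /wint -RintegralB//; apply: eq_Rintegral => x _; rewrite mulrBr.
Qed.

Lemma eq_wint f g : f =1 g -> wint f = wint g.
Proof. by move=> /funext ->. Qed.

Lemma wint_ge0 f : (forall x, 0 <= f x) -> 0 <= wint f.
Proof. by move=> f0; apply: Rintegral_ge0 => x _; rewrite mulr_ge0. Qed.

Lemma le_wint f g : wintegrable f -> wintegrable g ->
  (forall x, f x <= g x) -> wint f <= wint g.
Proof. by move=> fi gi fg; apply: le_Rintegral => // x _; rewrite ler_wpM2l. Qed.

Let T2 := (measurableTypeR R * measurableTypeR R)%type.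

Let measurable_wkernel (h : R -> R -> R) :
  measurable_fun [set: T2] (fun z : T2 => h z.1 z.2) ->
  measurable_fun [set: T2] (fun z : T2 => (q z.1 * h z.1 z.2)%:E).
Proof.
move=> mh; apply/measurable_EFinP/measurable_funM => //.
by apply: measurableT_comp => //; exact: measurable_fst.
Qed.

Lemma measurable_wint_param (h : R -> R -> R) :
  measurable_fun [set: T2] (fun z : T2 => h z.1 z.2) ->
  (forall x u, 0 <= h x u) ->
  measurable_fun [set: measurableTypeR R]
    (fun u : measurableTypeR R => \int[P]_x (q x * h x u)%:E)%E.
Proof.
move=> mh h0.
apply: (measurable_fun_fubini_tonelli_G (m1 := P)
  (fun z : T2 => (q z.1 * h z.1 z.2)%:E)).
  exact: measurable_wkernel.
by move=> z; rewrite lee_fin mulr_ge0.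
Qed.

(** Tonelli's theorem, with [D] absorbed into the kernel as an indicator. Both sides may be
    infinite, so it also serves to prove integrability. *)
Lemma wint_tonelli (D : set (measurableTypeR R)) (h : R -> R -> R) (H : R -> R) :
  measurable D ->
  measurable_fun [set: T2] (fun z : T2 => h z.1 z.2) ->
  (forall x u, 0 <= h x u) ->
  (forall x, \int[mu]_(u in D) (h x u)%:E = (H x)%:E)%E ->
  (\int[P]_x (q x * H x)%:E = \int[mu]_(u in D) \int[P]_x (q x * h x u)%:E)%E.
Proof.
move=> mD mh h0 hH.
pose k x u := h x u * \1_D u.
have k0 x u : 0 <= k x u by rewrite mulr_ge0.
have mk : measurable_fun [set: T2] (fun z : T2 => k z.1 z.2).
  apply: measurable_funM => //.
  apply: (@measurableT_comp _ _ _ _ _ _ (\1_D : measurableTypeR R -> R)) => //.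
transitivity (\int[P]_x \int[mu]_u (q x * k x u)%:E)%E.
  apply: eq_integral => x _; rewrite EFinM -hH integral_mkcond.
  rewrite -ge0_integralZl//=; first last.
  - by rewrite lee_fin.
  - by move=> u _; rewrite patchE; case: ifPn => // _; rewrite lee_fin.
  - apply/(measurable_restrictT _ _).1 => //; apply/measurable_funTS/measurable_EFinP.
    exact: (measurable_fun_pair2 x mh).
  apply: eq_integral => u _; rewrite patchE /k indicE.
  by case: ifPn => uD; rewrite ?mulr1 ?mulr0 -?EFinM ?mulr0// mule0.
rewrite (fubini_tonelli (fun z : T2 => (q z.1 * k z.1 z.2)%:E)); first last.
- by move=> z; rewrite lee_fin mulr_ge0.
- exact: measurable_wkernel.
rewrite [RHS]integral_mkcond; apply: eq_integral => u _.
rewrite patchE /k /= indicE; case: ifPn => uD.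
  by apply: eq_integral => x _; rewrite mulr1.
by apply: integral0_eq => x _; rewrite !mulr0.
Qed.

End weighted_integral.

(** * Kernels of the quantile equation *)

Section gaussian_kernels.
Context {R : realType} (c : R).
Local Notation mu := (@lebesgue_measure R).
Implicit Types (r s x y h : R).

Definition gker y : R := normal_pdf 0 1 (c - y).

(** The integral of [gker] over [z > y]. When [c] is the quantile of N(0, 1) at level alpha,
    [gtail 0] is alpha. *)
Definition gtail y : R := std_normal_cdf (c - y).

(* The integral of [((0 < z)%R%:R - gtail 0) * gker z] over [z > y]. *)
Definition gjump y : R := gtail (Num.max y 0) - gtail 0 * gtail y.

(** Minus the integral of [z * gker z] over [z > y], hence an antiderivative of [y * gker y]. *)
Definition gmom y : R := - (c * gtail y) - gker y.

(** The first factor has slope [1 - gtail 0] on the right of 0 and [- gtail 0] on the left: it is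
    the check function of quantile regression at level [1 - gtail 0]. *)
Definition gnu y : R := (Num.max y 0 - gtail 0 * y) * gker y.

(** An antiderivative of [gnu]: on the negative half-line the first term is frozen at [gmom 0]. *)
Definition gnuprim y : R := gmom (Num.max y 0) - gtail 0 * gmom y.

Lemma gkerE y : gker y = normal_peak 1 * expR (- (c - y) ^+ 2 / 2).
Proof. by rewrite /gker normal_pdf1E subr0. Qed.

Lemma gker_gt0 y : 0 < gker y. Proof. exact: normal_pdf1_gt0. Qed.

Lemma gker_ge0 y : 0 <= gker y. Proof. exact: ltW (gker_gt0 y). Qed.

Lemma is_derive_gtail y : is_derive y 1 (fun x => - gtail x) (gker y).
Proof.
have : is_derive y 1 gtail (normal_pdf 0 1 (c - y) * (0 - 1)).
  exact: (@is_derive1_comp _ (@std_normal_cdf R) (fun x => c - x)).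
by move=> d; apply: is_derive_eq; rewrite /gker; ring.
Qed.

Lemma is_derive_gker y : is_derive y 1 gker ((c - y) * gker y).
Proof.
have : is_derive y 1 gker (- (c - y) * normal_pdf 0 1 (c - y) * (0 - 1)).
  exact: (@is_derive1_comp _ (@normal_pdf R 0 1) (fun x => c - x)).
by move=> d; apply: is_derive_eq; rewrite /gker; ring.
Qed.

Lemma is_derive_gmom y : is_derive y 1 gmom (y * gker y).
Proof.
have d1 := is_derive_gtail y; have d2 := is_derive_gker y.
have -> : gmom = (fun x => c * - gtail x - gker x).
  by apply/funext => x; rewrite /gmom mulrN.
by apply: is_derive_eq; rewrite /GRing.scale/=; ring.
Qed.

Lemma continuous_gker : continuous gker.
Proof. exact: is_derive_continuous is_derive_gker. Qed.

Lemma continuous_gtail : continuous gtail.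
Proof.
move=> y; rewrite -[gtail]opprK; apply: cvgN.
exact: (is_derive_continuous is_derive_gtail).
Qed.

Lemma continuous_gmom : continuous gmom.
Proof. exact: is_derive_continuous is_derive_gmom. Qed.

Lemma measurable_gker : measurable_fun [set: R] gker.
Proof. exact: continuous_measurable_fun continuous_gker. Qed.

Lemma measurable_gtail : measurable_fun [set: R] gtail.
Proof. exact: continuous_measurable_fun continuous_gtail. Qed.

Let measurable_max0 : measurable_fun [set: R] (fun y : R => Num.max y 0).
Proof. exact: measurable_maxr. Qed.

Lemma measurable_gjump : measurable_fun [set: R] gjump.
Proof.
have mt := measurable_gtail; apply: measurable_funB; last exact: measurable_funM.
exact: measurableT_comp mt measurable_max0.
Qed.

Lemma measurable_gnu : measurable_fun [set: R] gnu.
Proof.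
apply: measurable_funM; last exact: measurable_gker.
by apply: measurable_funB => //; exact: measurable_funM.
Qed.

Lemma measurable_gnuprim : measurable_fun [set: R] gnuprim.
Proof.
have mm := continuous_measurable_fun continuous_gmom.
apply: measurable_funB; last exact: measurable_funM.
exact: measurableT_comp mm measurable_max0.
Qed.

Lemma gtail_itv y : 0 < gtail y < 1.
Proof. exact: std_normal_cdf_itv. Qed.

Lemma gtail_le x y : x <= y -> gtail y <= gtail x.
Proof. by move=> xy; apply: std_normal_cdf_le; rewrite lerD2l lerN2. Qed.

(** The value is [gtail 0 * (1 - gtail y)] on the left of 0 and [(1 - gtail 0) * gtail y] on the
    right. *)
Lemma gjump_ge0 y : 0 <= gjump y.
Proof.
have := gtail_itv 0; have := gtail_itv y; rewrite /gjump.
by have [y0|y0] := leP y 0; nra.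
Qed.

(** The Gaussian tail bound at [c - y], which is at most the absolute value of [c]; the constant
    cancels the peak of the density. *)
Lemma gtail_le_gker y : 0 <= y ->
  gtail y <= expR (c ^+ 2 / 2) / normal_peak 1 * gker y.
Proof.
move=> y0; rewrite gkerE mulrA divfK ?gt_eqF ?normal_peak_gt0//.
by apply: std_normal_cdf_le_expR; have := ler_norm c; lra.
Qed.

Lemma gtailC_le_gker y : y <= 0 ->
  1 - gtail y <= expR (c ^+ 2 / 2) / normal_peak 1 * gker y.
Proof.
move=> y0; rewrite gkerE mulrA divfK ?gt_eqF ?normal_peak_gt0//.
by apply: std_normal_cdfC_le_expR; have := ler_norm (- c); rewrite normrN; lra.
Qed.

(** This domination transfers integrability from [gker] to [gjump]. *)
Lemma gjump_le_gker y : gjump y <= expR (c ^+ 2 / 2) / normal_peak 1 * gker y.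
Proof.
have := gtail_itv 0; have := gtail_itv y; rewrite /gjump.
have [y0|y0] := leP y 0; first by have := gtailC_le_gker y0; nra.
by have := gtail_le_gker (ltW y0); nra.
Qed.

(** On the left of 0 [gjump] is nondecreasing, so [k] is its value at [- h]. The bound turns control
    of the integral of [gjump] into control of the mass of windows of length [h]. *)
Lemma gjump_lower h : 0 <= h ->
  exists2 k, 0 < k & forall y, - h <= y <= 0 -> k <= gjump y.
Proof.
move=> h0; have := gtail_itv 0; have := gtail_itv (- h) => hh h00.
exists (gtail 0 * (1 - gtail (- h))); first by nra.
move=> y /andP[hy y0]; rewrite /gjump (max_idPr y0).
by have := gtail_le hy; nra.
Qed.

Lemma gnu_ge0 y : 0 <= gnu y.
Proof.
rewrite mulr_ge0 ?gker_ge0//; have := gtail_itv 0.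
by have [y0|y0] := leP y 0; nra.
Qed.

(** The lower bound on the kernel required by the Liouville theorem. For [1 <= y <= M] the linear
    factor is at least [1 - gtail 0], and the Gaussian factor is bounded through the triangle
    inequality for [c - y]. *)
Lemma gnu_lower M : exists2 k, 0 < k & forall y, 1 <= y <= M -> k <= gnu y.
Proof.
have := gtail_itv 0 => h0.
exists ((1 - gtail 0) * (normal_peak 1 * expR (- (`|c| + `|M|) ^+ 2 / 2))).
  by rewrite mulr_gt0 ?mulr_gt0 ?expR_gt0 ?normal_peak_gt0//; lra.
move=> y /andP[y1 yM]; rewrite /gnu gkerE (max_idPl _); last by lra.
rewrite (_ : y - gtail 0 * y = (1 - gtail 0) * y); last by ring.
rewrite -[leRHS]mulrA ler_wpM2l//; first by lra.
rewrite -[leLHS]mul1r ler_pM// ?mulr_ge0 ?normal_peak_ge0 ?expR_ge0//.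
rewrite ler_wpM2l ?normal_peak_ge0// ler_expR.
suff : (c - y) ^+ 2 <= (`|c| + `|M|) ^+ 2 by lra.
have := ler_norm c; have := ler_norm (- c); rewrite normrN.
by have := ler_norm M; nra.
Qed.

(** The kernel is split at 0 into two nonnegative pieces, each integrated by a step lemma with
    [x = 0]; hence the terms [y - 0]. *)
Lemma integral_gnu r s : r <= s ->
  (\int[mu]_(y in `]r, s]) (gnu y)%:E = (gnuprim s - gnuprim r)%:E)%E.
Proof.
move=> rs; have h0 := gtail_itv 0.
have cf : continuous (fun y => y * gker y).
  by move=> y; apply: cvgM; [exact: cvg_id|exact: continuous_gker].
have I1 := @integral_oc_step _ gmom _ 0 r s is_derive_gmom cf rs.
have dN (y : R) : is_derive y 1 (fun y => - gmom y) (- (y * gker y)).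
  have d := is_derive_gmom y; exact: is_deriveN.
have cN : continuous (fun y => - (y * gker y)).
  by move=> y; apply: cvgN; exact: cf.
have I2 := @integral_oc_stepN _ _ _ 0 r s dN cN rs.
have mf : measurable_fun [set: R] (fun y => y * gker y).
  exact: continuous_measurable_fun.
under eq_integral => y _.
  rewrite (_ : gnu y = (1 - gtail 0) * ((0 < y)%R%:R * ((y - 0) * gker (y - 0)))
    + gtail 0 * ((y <= 0)%R%:R * - ((y - 0) * gker (y - 0)))); last first.
    rewrite /gnu subr0; have [y0|y0] := leP y 0; rewrite ?mul0r ?mul1r; ring.
  rewrite EFinD (EFinM (1 - gtail 0)) (EFinM (gtail 0)).
  over.
have mf0 : measurable_fun [set: R] (fun y => (y - 0) * gker (y - 0)).
  by under eq_fun do rewrite subr0.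
have pos y : 0 <= (0 < y)%R%:R * ((y - 0) * gker (y - 0)).
  rewrite subr0; have [y0|y0] := leP y 0; first by rewrite mul0r.
  by rewrite !mulr_ge0 ?gker_ge0 ?ltW.
have neg y : 0 <= (y <= 0)%R%:R * - ((y - 0) * gker (y - 0)).
  rewrite subr0; have [y0|y0] := leP y 0; last by rewrite mul0r.
  by rewrite mul1r -mulNr mulr_ge0 ?gker_ge0 ?oppr_ge0.
have mpos : measurable_fun [set: R]
    (fun y => (0 < y)%R%:R * ((y - 0) * gker (y - 0))).
  apply: measurable_funM => //.
  by apply: measurable_natrb; exact: measurable_fun_ltr.
have mneg : measurable_fun [set: R]
    (fun y => (y <= 0)%R%:R * - ((y - 0) * gker (y - 0))).
  apply: measurable_funM; last exact: measurableT_comp.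
  by apply: measurable_natrb; exact: measurable_fun_ler.
rewrite ge0_integralD//=; first last.
- by apply/measurable_funTS/measurable_EFinP; exact: measurable_funM.
- by move=> y _; rewrite lee_fin mulr_ge0//; lra.
- by apply/measurable_funTS/measurable_EFinP; exact: measurable_funM.
- by move=> y _; rewrite lee_fin mulr_ge0//; lra.
have a0 : (0 <= (gtail 0)%:E)%E by rewrite lee_fin; lra.
have a1 : (0 <= (1 - gtail 0)%:E)%E by rewrite lee_fin; lra.
rewrite !ge0_integralZl//.
all: try exact/measurable_funTS/measurable_EFinP.
all: try by move=> y _; rewrite lee_fin.
rewrite I1 I2 -!EFinM -EFinD !subr0 /gnuprim; congr EFin.
by have [s0|s0] := leP s 0; have [r0|r0] := leP r 0; ring.
Qed.

(** From [(c - y / 2) ^+ 2 >= 0] the exponent is at most [c ^+ 2 / 2 - y ^+ 2 / 4]. Then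
    [expR z >= 1 + z] and [n + 1 <= 4 + n ^+ 2] give the crude rate. *)
Lemma gker_le_harmonic y (n : nat) : `|y| = n%:R ->
  gker y <= normal_peak 1 * expR (c ^+ 2 / 2) * 4 * harmonic n.
Proof.
move=> yn; rewrite gkerE -(mulrA (_ * _) 4) -(mulrA (normal_peak 1)).
rewrite ler_wpM2l ?normal_peak_ge0//.
have n1 : 0 < n.+1%:R :> R by rewrite ltr0n.
have le1 : expR (- (c - y) ^+ 2 / 2) <= expR (c ^+ 2 / 2) * expR (- (n%:R ^+ 2 / 4)).
  rewrite -expRD ler_expR -yn real_normK ?num_real//.
  by have := sqr_ge0 (c - y / 2); nra.
apply: (le_trans le1); rewrite ler_wpM2l ?expR_ge0//.
have e1 : 1 + n%:R ^+ 2 / 4 <= expR (n%:R ^+ 2 / 4) :> R by exact: expR_ge1Dx.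
rewrite expRN /harmonic/= ler_pdivlMr// mulrC ler_pdivrMr ?expR_gt0//.
have : n%:R * 1 <= n%:R * n%:R + 3 :> R.
  by have := sqr_ge0 (n%:R - 1 : R); nra.
by rewrite -natr1; nra.
Qed.

(** At +oo [gnuprim] tends to 0. At -oo the terms [- c * gtail 0] from [gmom 0] and [c * gtail 0]
    from the limit of [- gtail 0 * gmom] cancel, which leaves [- gker 0]. *)
Lemma cvg_gnuprim :
  gnuprim n%:R - gnuprim (- n%:R) @[n --> \oo] --> gker 0.
Proof.
have h0 := gtail_itv 0.
pose E := expR (c ^+ 2 / 2) / normal_peak 1.
have E0 : 0 <= E by rewrite divr_ge0 ?expR_ge0 ?normal_peak_ge0.
pose A : R := normal_peak 1 * expR (c ^+ 2 / 2) * 4.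
pose D := 2 * (`|c| * E + 1) * A.
have bnd n : `|gnuprim n%:R - gnuprim (- n%:R) - gker 0| <= D * harmonic n.
  have n0 : 0 <= n%:R :> R by [].
  have k1 : gker n%:R <= A * harmonic n.
    by apply: gker_le_harmonic; rewrite ger0_norm.
  have k2 : gker (- n%:R) <= A * harmonic n.
    by apply: gker_le_harmonic; rewrite normrN ger0_norm.
  have t1 := gtail_le_gker n0.
  have t2 : 1 - gtail (- n%:R) <= E * gker (- n%:R).
    by apply: gtailC_le_gker; rewrite oppr_le0.
  have := gtail_itv n%:R; have := gtail_itv (- n%:R) => i2 i1.
  have p1 := gker_ge0 n%:R; have p2 := gker_ge0 (- n%:R).
  rewrite /gnuprim (max_idPl _)// (@max_idPr _ _ (- n%:R) 0 _) ?oppr_le0//.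
  rewrite /gmom.
  set T1 := gtail n%:R in t1 i1 *; set T2 := gtail (- n%:R) in t2 i2 *.
  set a := gtail 0 in h0 *.
  rewrite (_ : _ - gker 0 = a * c * (1 - T2) - (1 - a) * c * T1
    - (1 - a) * gker n%:R - a * gker (- n%:R)); last by ring.
  have cT1 : `|c| * T1 <= `|c| * E * (A * harmonic n).
    rewrite -mulrA ler_wpM2l// (le_trans t1)// ler_wpM2l//.
  have cT2 : `|c| * (1 - T2) <= `|c| * E * (A * harmonic n).
    rewrite -mulrA ler_wpM2l// (le_trans t2)// ler_wpM2l//.
  have n1 : `|a * c * (1 - T2)| <= `|c| * (1 - T2).
    rewrite !normrM (ger0_norm (_ : 0 <= a)) ?(ger0_norm (_ : 0 <= 1 - T2)); try lra.
    rewrite -mulrA ler_piMl ?mulr_ge0//; lra.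
  have n2 : `|(1 - a) * c * T1| <= `|c| * T1.
    rewrite !normrM (ger0_norm (_ : 0 <= 1 - a)) ?(ger0_norm (_ : 0 <= T1)); try lra.
    rewrite -mulrA ler_piMl ?mulr_ge0//; lra.
  have n3 : (1 - a) * gker n%:R <= gker n%:R by nra.
  have n4 : a * gker (- n%:R) <= gker (- n%:R) by nra.
  have p3 : 0 <= (1 - a) * gker n%:R by rewrite mulr_ge0//; lra.
  have p4 : 0 <= a * gker (- n%:R) by rewrite mulr_ge0//; lra.
  move: n1 n2; rewrite /D !ler_norml => /andP[? ?] /andP[? ?].
  by apply/andP; split; lra.
have Dh : D * harmonic n @[n --> \oo] --> (0 : R).
  rewrite -[X in _ --> X](mulr0 D).
  by apply: cvgM; [exact: cvg_cst|exact: cvg_harmonic].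
apply: (@squeeze_cvgr _ _ _ _ (fun n => gker 0 - D * harmonic n)
  (fun n => gker 0 + D * harmonic n)).
- apply: nearW => n; have := bnd n; rewrite ler_norml => /andP[? ?].
  by apply/andP; split; lra.
- by rewrite -[X in _ --> X]subr0; apply: cvgB => //; exact: cvg_cst.
- by rewrite -[X in _ --> X]addr0; apply: cvgD => //; exact: cvg_cst.
Qed.

Lemma integral_gnuT : (\int[mu]_y (gnu y)%:E = (gker 0)%:E)%E.
Proof.
pose F (n : nat) := `](- n%:R : R), n%:R]%classic.
have UF : \bigcup_n F n = [set: R].
  apply/seteqP; split => // x _; exists (Num.bound `|x|) => //.
  rewrite /F/= in_itv/=; have := archi_boundP (normr_ge0 x).
  by rewrite ltr_norml => /andP[-> /ltW].
rewrite -UF; apply/esym/(@cvg_unique _ _ (\int[mu]_(y in F n) (gnu y)%:E @[n --> \oo])%E).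
- exact: ereal_hausdorff.
- rewrite (_ : (fun n => _) =
      (fun n => (gnuprim n%:R - gnuprim (- n%:R))%:E)); last first.
    by apply/funext => n; rewrite /F integral_gnu// (@le_trans _ _ 0)// oppr_le0.
  apply/cvg_EFin; first by apply: nearW.
  exact: cvg_gnuprim.
- apply: ge0_nondecreasing_set_cvg_integral => //=.
  + move=> m n mn; apply/subsetPset => x; rewrite /F/= !in_itv/= => /andP[mx xm].
    have mnR : m%:R <= n%:R :> R by rewrite ler_nat.
    by apply/andP; split; lra.
  + by move=> n; exact: measurable_itv.
  + by move=> n; apply/measurable_funTS/measurable_EFinP; exact: measurable_gnu.
  + by move=> n x _; rewrite lee_fin gnu_ge0.
Qed.

End gaussian_kernels.

(** * From the quantile inequalities to the Lebesgue measure *)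

Section gaussian_balance.
Context {R : realType} (P : probability (measurableTypeR R) R) (q : R -> R).
Hypotheses (mq : measurable_fun [set: R] q) (q_ge0 : forall x, 0 <= q x).
Context (c : R).
Local Notation mu := (@lebesgue_measure R).
Local Notation gker := (gker c).
Local Notation gtail := (gtail c).
Local Notation gjump := (gjump c).
Local Notation gnu := (gnu c).
Local Notation gnuprim := (gnuprim c).
Local Notation alpha := (gtail 0).
Local Notation wintegrable := (wintegrable P q).
Local Notation wint := (wint P q).
Implicit Types (r s u x y h : R).
Hypothesis gker_int : forall u, wintegrable (fun x => gker (u - x)).
Hypothesis gker_loc : forall r s, exists C, forall u, r <= u <= s ->
  wint (fun x => gker (u - x)) <= C.
(** The next two hypotheses are the quantile inequalities at the threshold [u], written with the
    weight and multiplied by a factor depending on [u] only. *)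
Hypothesis balance_lt : forall u,
  wint (fun x => (x < u)%R%:R * gker (u - x)) <=
  alpha * wint (fun x => gker (u - x)).
Hypothesis balance_le : forall u,
  alpha * wint (fun x => gker (u - x)) <=
  wint (fun x => (x <= u)%R%:R * gker (u - x)).

Let T2 := (measurableTypeR R * measurableTypeR R)%type.

Let mfst : measurable_fun [set: T2] (fun z : T2 => (z.1 : R)).
Proof. exact: measurable_fst. Qed.

Let msnd : measurable_fun [set: T2] (fun z : T2 => (z.2 : R)).
Proof. exact: measurable_snd. Qed.

Let msub (f : R -> R) u : measurable_fun [set: R] f ->
  measurable_fun [set: R] (fun x => f (u - x)).
Proof. by move=> mf; apply: (measurableT_comp mf); exact: measurable_funB. Qed.

Let msub2 (f : R -> R) : measurable_fun [set: R] f ->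
  measurable_fun [set: T2] (fun z : T2 => f (z.2 - z.1)).
Proof. by move=> mf; apply: (measurableT_comp mf); exact: measurable_funB. Qed.

Let mgk := measurable_gker c.

Let natr_le1 (b : bool) : 0 <= (b%:R : R) <= 1.
Proof. by case: b; rewrite lexx ler01. Qed.

Let lt_int u : wintegrable (fun x => (x < u)%R%:R * gker (u - x)).
Proof.
apply: (le_wintegrable mq _ _ (gker_int u)).
  apply: measurable_funM; last exact: msub.
  by apply: measurable_natrb; exact: measurable_fun_ltr.
move=> x; have /andP[b0 b1] := natr_le1 (x < u).
by rewrite ger0_norm ?mulr_ge0 ?gker_ge0// ler_piMl ?gker_ge0.
Qed.

Let le_int u : wintegrable (fun x => (x <= u)%R%:R * gker (u - x)).
Proof.
apply: (le_wintegrable mq _ _ (gker_int u)).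
  apply: measurable_funM; last exact: msub.
  by apply: measurable_natrb; exact: measurable_fun_ler.
move=> x; have /andP[b0 b1] := natr_le1 (x <= u).
by rewrite ger0_norm ?mulr_ge0 ?gker_ge0// ler_piMl ?gker_ge0.
Qed.

(** * Integrating the quantile inequalities over the threshold *)

Let slab r s x := gtail (r - x) - gtail (s - x).

(** [slab r s x] is the integral of [gker (u - x)] over [u] in []r, s]], and [cut r s x] keeps only
    the part [u > x]. *)
Let cut r s x := gtail (Num.max r x - x) - gtail (Num.max s x - x).

Let cut_le_slab r s x : r <= s -> 0 <= cut r s x <= slab r s x.
Proof.
move=> rs; rewrite /cut /slab; have rsx : r - x <= s - x by rewrite lerD2r.
have := @gtail_le _ c _ _ rsx.
case: (leP r x) => rx; case: (leP s x) => sx; rewrite ?subrr.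
- by lra.
- have s0 : 0 <= s - x by rewrite subr_ge0 ltW.
  have r0 : r - x <= 0 by rewrite subr_le0.
  by have := @gtail_le _ c _ _ s0; have := @gtail_le _ c _ _ r0; lra.
- by move: (lt_le_trans rx rs); rewrite ltNge sx.
- by lra.
Qed.

(** Tonelli reduces the claim to an integral over the bounded interval []r, s]], where [gker_loc]
    bounds the integrand. *)
Let slab_int r s : r <= s -> wintegrable (slab r s).
Proof.
move=> rs; have [C eC] := gker_loc r s.
have mt := @measurable_gtail _ c.
apply: ge0_wintegrable => //.
- by apply: measurable_funB; exact: msub.
- move=> x; have /andP[? ?] := @cut_le_slab r s x rs.
  exact: (@le_trans _ _ (cut r s x)).
rewrite (@wint_tonelli _ _ _ mq q_ge0 `]r, s]%classic (fun x u => gker (u - x)))//.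
- apply: (@le_lt_trans _ _ (\int[mu]_(u in `]r, s]) (cst C%:E u))%E).
    apply: ge0_le_integral => //.
    + by move=> u _; apply: integral_ge0 => x _; rewrite lee_fin mulr_ge0 ?gker_ge0.
    + apply/measurable_funTS; apply: measurable_wint_param => //; first exact: msub2.
      by move=> x u; exact: gker_ge0.
    + move=> u; rewrite /= in_itv/= => /andP[ru us].
      by rewrite -EFin_wint// lee_fin eC// us ltW.
  rewrite integral_cst//= lebesgue_measure_itv/=.
  by case: ifPn => _; rewrite ?mule0 ?ltry// -EFinB -EFinM ltry.
- exact: msub2.
- by move=> x u; exact: gker_ge0.
- move=> x.
  have := @integral_oc _ _ _ r s (is_derive_comp_subr x (@is_derive_gtail _ c))
    (@continuous_comp_subr _ _ x (@continuous_gker _ c)) rs.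
  by move=> ->; rewrite /slab; congr EFin; ring.
Qed.

Let cut_int r s : r <= s -> wintegrable (cut r s).
Proof.
move=> rs; have mt := @measurable_gtail _ c.
apply: (le_wintegrable mq _ _ (slab_int rs)).
  by apply: measurable_funB; apply: (measurableT_comp mt);
    apply: measurable_funB => //; exact: measurable_maxr.
by move=> x; have /andP[? ?] := @cut_le_slab r s x rs; rewrite ger0_norm.
Qed.

(** Both balance inequalities are integrated over [u] in []r, s]]. The left side of one and the
    right side of the other integrate to the same [cut], so the two inequalities become an
    equality. *)
Let wint_cut r s : r <= s -> wint (cut r s) = alpha * wint (slab r s).
Proof.
move=> rs; have h0 := gtail_itv c 0.
have mdsub := msub2 mgk.
have mlt : measurable_fun [set: T2]
    (fun z : T2 => (z.1 < z.2)%R%:R * gker (z.2 - z.1)).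
  by apply: measurable_funM => //; apply: measurable_natrb; exact: measurable_fun_ltr.
have mle : measurable_fun [set: T2]
    (fun z : T2 => (z.1 <= z.2)%R%:R * gker (z.2 - z.1)).
  by apply: measurable_funM => //; apply: measurable_natrb; exact: measurable_fun_ler.
have E1 := @wint_tonelli _ P _ mq q_ge0 `]r, s]%classic
  (fun x u => (x < u)%R%:R * gker (u - x)) (cut r s)
  (measurable_itv _) mlt.
have E2 := @wint_tonelli _ P _ mq q_ge0 `]r, s]%classic
  (fun x u => (x <= u)%R%:R * gker (u - x)) (cut r s)
  (measurable_itv _) mle.
have E3 := @wint_tonelli _ P _ mq q_ge0 `]r, s]%classic
  (fun x u => gker (u - x)) (slab r s)
  (measurable_itv _) mdsub.
have p1 x u : 0 <= (x < u)%R%:R * gker (u - x) by rewrite mulr_ge0 ?gker_ge0.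
have p2 x u : 0 <= (x <= u)%R%:R * gker (u - x) by rewrite mulr_ge0 ?gker_ge0.
have p3 x u : 0 <= gker (u - x) by rewrite gker_ge0.
have {}E1 := E1 p1; have {}E2 := E2 p2; have {}E3 := E3 p3.
have {}E1 : (\int[P]_x (q x * cut r s x)%:E =
    \int[mu]_(u in `]r, s]) \int[P]_x (q x * ((x < u)%R%:R * gker (u - x)))%:E)%E.
  apply: E1 => x.
  rewrite (@integral_oc_step _ _ _ x r s (@is_derive_gtail _ c) (@continuous_gker _ c) rs).
  by rewrite /cut; congr EFin; ring.
have {}E2 : (\int[P]_x (q x * cut r s x)%:E =
    \int[mu]_(u in `]r, s]) \int[P]_x (q x * ((x <= u)%R%:R * gker (u - x)))%:E)%E.
  apply: E2 => x.
  rewrite (@integral_oc_cstep _ _ _ x r s (@is_derive_gtail _ c) (@continuous_gker _ c) rs).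
  by rewrite /cut; congr EFin; ring.
have {}E3 : (\int[P]_x (q x * slab r s x)%:E =
    \int[mu]_(u in `]r, s]) \int[P]_x (q x * gker (u - x))%:E)%E.
  apply: E3 => x.
  have := @integral_oc _ _ _ r s (is_derive_comp_subr x (@is_derive_gtail _ c))
    (@continuous_comp_subr _ _ x (@continuous_gker _ c)) rs.
  by move=> ->; rewrite /slab; congr EFin; ring.
have m1 := @measurable_wint_param _ P _ mq q_ge0 _ mlt p1.
have m2 := @measurable_wint_param _ P _ mq q_ge0 _ mle p2.
have m3 := @measurable_wint_param _ P _ mq q_ge0 _ mdsub p3.
have aE : ((alpha * wint (slab r s))%:E = \int[mu]_(u in `]r, s])
    (alpha%:E * \int[P]_x (q x * gker (u - x))%:E))%E.
  rewrite ge0_integralZl//.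
  - by rewrite EFinM (EFin_wint (slab_int rs)) E3.
  - exact/measurable_funTS.
  - by move=> u _; apply: integral_ge0 => x _; rewrite lee_fin mulr_ge0.
  - by rewrite lee_fin; lra.
have ma : measurable_fun `]r, s]
    (fun u => alpha%:E * \int[P]_x (q x * gker (u - x))%:E)%E.
  by apply/measurable_funTS/measurable_funeM.
apply/eqP; rewrite eq_le -!lee_fin (EFin_wint (cut_int rs)) aE.
apply/andP; split; [rewrite E1|rewrite E2]; apply: ge0_le_integral => //.
- by move=> u _; apply: integral_ge0 => x _; rewrite lee_fin mulr_ge0.
- exact/measurable_funTS.
- by move=> u _; rewrite -(EFin_wint (lt_int u)) -(EFin_wint (gker_int u)) -EFinM lee_fin.
- move=> u _; rewrite mule_ge0 ?lee_fin//; first by lra.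
  by apply: integral_ge0 => x _; rewrite lee_fin mulr_ge0.
- exact/measurable_funTS.
- by move=> u _; rewrite -(EFin_wint (le_int u)) -(EFin_wint (gker_int u)) -EFinM lee_fin.
Qed.

Let jump_int u : wintegrable (fun x => gjump (u - x)).
Proof.
have := wintegrableZ (expR (c ^+ 2 / 2) / normal_peak 1) (gker_int u).
apply: le_wintegrable => //; first exact: msub (measurable_gjump c).
by move=> x; rewrite ger0_norm ?gjump_ge0// gjump_le_gker.
Qed.

(** Pointwise the difference of the two integrands is [cut r s x - alpha * slab r s x], whose
    weighted integral vanishes. *)
Let wint_jump r s : r <= s ->
  wint (fun x => gjump (r - x)) = wint (fun x => gjump (s - x)).
Proof.
move=> rs; apply/eqP; rewrite -subr_eq0 -wintB//.
have -> : wint (fun x => gjump (r - x) - gjump (s - x)) =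
    wint (fun x => cut r s x - alpha * slab r s x).
  apply: eq_wint => x; have maxE t : Num.max t x - x = Num.max (t - x) 0.
    by rewrite addr_maxl subrr.
  by rewrite /cut !maxE /slab /gjump; ring.
rewrite (wintB (cut_int rs) (wintegrableZ alpha (slab_int rs))).
by rewrite (wintZ alpha (slab_int rs)) (wint_cut rs) subrr.
Qed.

(** * Masses of closed and open windows, and the smoothed mass *)

Let cwin h u x : R := (u <= x <= u + h)%R%:R.

Let owin h u x : R := (u < x < u + h)%R%:R.

Let measurable_cwin h : measurable_fun [set: T2] (fun z : T2 => cwin h z.2 z.1).
Proof.
apply: measurable_natrb; apply: measurable_and; apply: measurable_fun_ler => //.
exact: measurable_funD.
Qed.

Let measurable_owin h : measurable_fun [set: T2] (fun z : T2 => owin h z.2 z.1).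
Proof.
apply: measurable_natrb; apply: measurable_and; apply: measurable_fun_ltr => //.
exact: measurable_funD.
Qed.

(** For [x] in the window, [u - x] lies between [- h] and 0, where [gjump] is at least [k]. The
    resulting bound does not depend on [u] because the integral of [gjump (u - x)] does not. *)
Let cwin_bound h : 0 <= h -> exists B, forall u,
  wintegrable (cwin h u) /\ wint (cwin h u) <= B.
Proof.
move=> h0; have [k k0 kle] := gjump_lower c h0.
have le u x : cwin h u x <= k^-1 * gjump (u - x).
  rewrite /cwin; case: (boolP (u <= x <= u + h)) => [/andP[ux xu]|_] /=.
    by rewrite ler_pdivlMl// mulr1 kle//; apply/andP; split; lra.
  by rewrite mulr_ge0 ?gjump_ge0// invr_ge0 ltW.
exists (k^-1 * wint (fun x => gjump (0 - x))) => u.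
have i1 : wintegrable (fun x => k^-1 * gjump (u - x)).
  exact/wintegrableZ/jump_int.
have i2 : wintegrable (cwin h u).
  apply: (le_wintegrable mq _ _ i1).
    exact: (measurable_fun_pair1 (u : measurableTypeR R) (@measurable_cwin h)).
  by move=> x; rewrite ger0_norm.
split => //; have -> : wint (fun x => gjump (0 - x)) = wint (fun x => gjump (u - x)).
  by have [u0|/ltW u0] := leP 0 u; [exact: wint_jump|apply/esym; exact: wint_jump].
by rewrite -(wintZ k^-1 (jump_int u)); exact: (le_wint q_ge0 i2 i1 (le u)).
Qed.

Let cwin_int h u : 0 <= h -> wintegrable (cwin h u).
Proof. by move=> /cwin_bound[B /(_ u)[]]. Qed.

Let owin_int h u : 0 <= h -> wintegrable (owin h u).
Proof.
move=> h0; apply: (le_wintegrable mq _ _ (cwin_int u h0)).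
  exact: (measurable_fun_pair1 (u : measurableTypeR R) (@measurable_owin h)).
move=> x; rewrite ger0_norm// /owin /cwin ler_nat.
by case: ltP => //= ux; case: ltP => //= xu; rewrite !ltW.
Qed.

(** The integral of [gnu] between [u - x] and [u + h - x], that is, the indicator of the window
    convolved with [gnu]; its weighted integral is the smoothed window mass. *)
Let inc h u x := gnuprim (u + h - x) - gnuprim (u - x).

Let inc_ge0 h u x : 0 <= h -> 0 <= inc h u x.
Proof.
move=> h0; have rs : u - x <= u + h - x by lra.
rewrite /inc -lee_fin -integral_gnu//; apply: integral_ge0 => y _.
by rewrite lee_fin gnu_ge0.
Qed.

Let measurable_inc h : measurable_fun [set: T2] (fun z : T2 => inc h z.2 z.1).
Proof.
have mn := measurable_gnuprim c; apply: measurable_funB.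
  apply: (measurableT_comp mn); apply: measurable_funB => //.
  exact: measurable_funD.
exact: msub2.
Qed.

(* After integration against the weight, the [gker] terms that jump at [x = u]
   or at [x = u + h] only contribute the atoms at the ends of the window. *)
Let incE_c h u x : 0 <= h -> inc h u x =
  gker 0 * cwin h u x
  + (alpha * gker (u + h - x) - (x <= u + h)%R%:R * gker (u + h - x))
  - (alpha * gker (u - x) - (x < u)%R%:R * gker (u - x))
  - c * (gjump (u + h - x) - gjump (u - x)).
Proof.
move=> h0; rewrite /inc /gnuprim /gmom /gjump /cwin.
have [xu|ux] := ltP x u.
  have -> : Num.max (u - x) 0 = u - x by apply/max_idPl; lra.
  have -> : Num.max (u + h - x) 0 = u + h - x by apply/max_idPl; lra.
  by rewrite (_ : x <= u + h) /=; [ring|lra].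
have -> : Num.max (u - x) 0 = 0 by apply/max_idPr; lra.
have [xs|sx] := leP x (u + h) => /=.
  have -> : Num.max (u + h - x) 0 = u + h - x by apply/max_idPl; lra.
  by ring.
have -> : Num.max (u + h - x) 0 = 0 by apply/max_idPr; lra.
by ring.
Qed.

(** The counterpart for the open window, with the two jump conventions exchanged. For [h = 0] it
    would fail at [x = u], where one jump term survives. *)
Let incE_o h u x : 0 < h -> inc h u x =
  gker 0 * owin h u x
  + (alpha * gker (u + h - x) - (x < u + h)%R%:R * gker (u + h - x))
  - (alpha * gker (u - x) - (x <= u)%R%:R * gker (u - x))
  - c * (gjump (u + h - x) - gjump (u - x)).
Proof.
move=> h0; rewrite /inc /gnuprim /gmom /gjump /owin.
have [xu|ux] := leP x u.
  have -> : Num.max (u - x) 0 = u - x by apply/max_idPl; lra.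
  have -> : Num.max (u + h - x) 0 = u + h - x by apply/max_idPl; lra.
  by have -> : x < u + h by [lra]; rewrite /=; ring.
have -> : Num.max (u - x) 0 = 0 by apply/max_idPr; lra.
have [xs|sx] := ltP x (u + h) => /=.
  have -> : Num.max (u + h - x) 0 = u + h - x by apply/max_idPl; lra.
  by ring.
have -> : Num.max (u + h - x) 0 = 0 by apply/max_idPr; lra.
by ring.
Qed.

(** By linearity; the term with factor [c] drops out because the weighted integral of [gjump] is
    translation invariant. *)
Let wintE (w f g : R -> R) r s : r <= s -> wintegrable w -> wintegrable f ->
  wintegrable g ->
  let F := fun x => gker 0 * w x + (alpha * gker (s - x) - f x)
    - (alpha * gker (r - x) - g x) - c * (gjump (s - x) - gjump (r - x)) in
  wintegrable F /\
  wint F = gker 0 * wint w + (alpha * wint (fun x => gker (s - x)) - wint f)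
    - (alpha * wint (fun x => gker (r - x)) - wint g).
Proof.
move=> rs wi fi gi F.
have i1 := wintegrableZ (gker 0) wi.
have i2 u := wintegrableZ alpha (gker_int u).
have i3 := wintegrableB (i2 s) fi.
have i4 := wintegrableB (i2 r) gi.
have i5 := wintegrableB (jump_int s) (jump_int r).
have i6 := wintegrableZ c i5.
have i7 := wintegrableD i1 i3.
have i8 := wintegrableB i7 i4.
split; first exact: wintegrableB i8 i6.
rewrite /F (wintB i8 i6) (wintB i7 i4) (wintD i1 i3) (wintB (i2 s) fi).
rewrite (wintB (i2 r) gi) (wintZ c i5) (wintB (jump_int s) (jump_int r)).
rewrite (wintZ (gker 0) wi) !(wintZ alpha (gker_int _)).
by rewrite (wint_jump rs) subrr mulr0 subr0.
Qed.

Let inc_int h u : 0 <= h -> wintegrable (inc h u).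
Proof.
move=> h0; have uh : u <= u + h by lra.
have [+ _] := wintE uh (cwin_int u h0) (le_int (u + h)) (lt_int u).
by congr (wintegrable _); apply/funext => x; rewrite incE_c.
Qed.

Let trim_le (a A1 a1 A2 a2 : R) :
  a1 <= A1 -> A2 <= a2 -> a + (A2 - a2) - (A1 - a1) <= a.
Proof. lra. Qed.

Let trim_ge (a A1 a1 A2 a2 : R) :
  A1 <= a1 -> a2 <= A2 -> a <= a + (A2 - a2) - (A1 - a1).
Proof. lra. Qed.

(** In the closed decomposition both correction terms are nonpositive, by [balance_lt] at [u] and
    [balance_le] at [u + h]. In the open one the inequalities exchange their endpoints and the
    corrections are nonnegative. *)
Let wint_inc_le h u : 0 <= h -> wint (inc h u) <= gker 0 * wint (cwin h u).
Proof.
move=> h0; have uh : u <= u + h by lra.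
have [_ e] := wintE uh (cwin_int u h0) (le_int (u + h)) (lt_int u).
rewrite (eq_wint _ _ (fun x => incE_c u x h0)) e.
exact: trim_le (balance_lt u) (balance_le (u + h)).
Qed.

Let wint_inc_ge h u : 0 < h -> gker 0 * wint (owin h u) <= wint (inc h u).
Proof.
move=> h0; have uh : u <= u + h by lra.
have [_ e] := wintE uh (owin_int u (ltW h0)) (lt_int (u + h)) (le_int u).
rewrite (eq_wint _ _ (fun x => incE_o u x h0)) e.
exact: trim_ge (balance_le u) (balance_lt (u + h)).
Qed.

(** By Tonelli, since [x] lies in the window at [u - y] exactly when [y] lies between [u - x] and
    [u + h - x]. Endpoints are Lebesgue-null, so the open window gives the same integral. *)
Let wint_inc_convol_c h u : 0 <= h ->
  ((wint (inc h u))%:E = \int[mu]_y (gnu y * wint (cwin h (u - y)))%:E)%E.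
Proof.
move=> h0; rewrite (EFin_wint (inc_int u h0)).
rewrite (@wint_tonelli _ _ _ mq q_ge0 [set: R]
  (fun x y => gnu y * cwin h (u - y) x))//.
- apply: eq_integral => y _; have i := cwin_int (u - y) h0.
  by rewrite -(wintZ (gnu y) i) (EFin_wint (wintegrableZ (gnu y) i)).
- apply: measurable_funM; first exact: (measurableT_comp (measurable_gnu c)).
  apply: measurable_natrb; apply: measurable_and; apply: measurable_fun_ler => //.
    exact: measurable_funB.
  by apply: measurable_funD => //; exact: measurable_funB.
- by move=> x y; rewrite mulr_ge0 ?gnu_ge0.
- move=> x; rewrite /inc -integral_gnu; last by lra.
  rewrite integral_itv_obnd_cbnd; last first.
    by apply/measurable_funTS/measurable_EFinP; exact: measurable_gnu.
  rewrite [RHS]integral_mkcond; apply: eq_integral => y _.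
  rewrite patchE /cwin mem_setE in_itv/=.
  rewrite (_ : (u - y <= x <= u - y + h) = (u - x <= y <= u + h - x)); last first.
    by apply/idP/idP => /andP[? ?]; apply/andP; split; lra.
  by case: ifP; rewrite ?mulr1 ?mulr0.
Qed.

Let wint_inc_convol_o h u : 0 <= h ->
  ((wint (inc h u))%:E = \int[mu]_y (gnu y * wint (owin h (u - y)))%:E)%E.
Proof.
move=> h0; rewrite (EFin_wint (inc_int u h0)).
rewrite (@wint_tonelli _ _ _ mq q_ge0 [set: R]
  (fun x y => gnu y * owin h (u - y) x))//.
- apply: eq_integral => y _; have i := owin_int (u - y) h0.
  by rewrite -(wintZ (gnu y) i) (EFin_wint (wintegrableZ (gnu y) i)).
- apply: measurable_funM; first exact: (measurableT_comp (measurable_gnu c)).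
  apply: measurable_natrb; apply: measurable_and; apply: measurable_fun_ltr => //.
    exact: measurable_funB.
  by apply: measurable_funD => //; exact: measurable_funB.
- by move=> x y; rewrite mulr_ge0 ?gnu_ge0.
- move=> x; rewrite /inc -integral_gnu; last by lra.
  rewrite (@integral_itv_bndoo _ (u - x) (u + h - x) (fun y => (gnu y)%:E)
    false false); last first.
    by apply/measurable_funTS/measurable_EFinP; exact: measurable_gnu.
  rewrite [RHS]integral_mkcond; apply: eq_integral => y _.
  rewrite patchE /owin mem_setE in_itv/=.
  rewrite (_ : (u - y < x < u - y + h) = (u - x < y < u + h - x)); last first.
    by apply/idP/idP => /andP[? ?]; apply/andP; split; lra.
  by case: ifP; rewrite ?mulr1 ?mulr0.
Qed.

(** * The convolution equation for the smoothed mass *)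

Let wint_inc_ge0 h u : 0 <= h -> 0 <= wint (inc h u).
Proof. by move=> h0; apply: wint_ge0 => // x; exact: inc_ge0. Qed.

Let measurable_wint_inc h : 0 <= h ->
  measurable_fun [set: R] (fun u => wint (inc h u)).
Proof.
move=> h0; apply/measurable_EFinP.
have -> : EFin \o (fun u => wint (inc h u)) =
    (fun u => (\int[P]_x (q x * inc h u x)%:E)%E).
  by apply/funext => u /=; rewrite (EFin_wint (inc_int u h0)).
exact: (@measurable_wint_param _ P _ mq q_ge0 (fun x u => inc h u x)
  (@measurable_inc h) (fun x u => inc_ge0 u x h0)).
Qed.

(** The smoothed mass is the convolution of [gnu] with the open and also with the closed window
    masses. Bounding these after multiplication by [gker 0] gives the two inequalities, and the
    atoms disappear. *)
Let wint_inc_convol h u : 0 < h ->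
  ((gker 0 * wint (inc h u))%:E =
   \int[mu]_y (gnu y * wint (inc h (u - y)))%:E)%E.
Proof.
move=> h0; have hle0 := ltW h0; have g0 := gker_gt0 c 0.
have gle0 : (0 <= (gker 0)%:E)%E by rewrite lee_fin ltW.
have mnu := measurable_gnu c.
have mi : measurable_fun [set: R] (fun y => gnu y * wint (inc h (u - y))).
  exact: measurable_convol_integrand mnu (measurable_wint_inc hle0).
have mwin (w : R -> R -> R) : measurable_fun [set: T2] (fun z : T2 => w z.2 z.1) ->
    (forall u x, 0 <= w u x) -> (forall u, wintegrable (w u)) ->
    measurable_fun [set: R] (fun y => gnu y * wint (w (u - y))).
  move=> mw w0 wi; apply: (measurable_convol_integrand (g := fun v => wint (w v))) => //.
  apply/measurable_EFinP.
  have -> : EFin \o (fun v => wint (w v)) =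
      (fun v => (\int[P]_x (q x * w v x)%:E)%E).
    by apply/funext => v /=; rewrite (EFin_wint (wi v)).
  exact: (@measurable_wint_param _ P _ mq q_ge0 (fun x u => w u x) mw
    (fun x u => w0 u x)).
have c0 v x : 0 <= cwin h v x by rewrite /cwin.
have o0 v x : 0 <= owin h v x by rewrite /owin.
have mc := mwin _ (@measurable_cwin h) c0 (fun v => cwin_int v hle0).
have mo := mwin _ (@measurable_owin h) o0 (fun v => owin_int v hle0).
apply/eqP; rewrite eq_le; apply/andP; split.
- rewrite EFinM (wint_inc_convol_o u hle0) -ge0_integralZl//.
  + apply: ge0_le_integral => //.
    * move=> y _; rewrite mule_ge0// lee_fin mulr_ge0 ?gnu_ge0//.
      exact: (wint_ge0 _ q_ge0 (o0 (u - y))).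
    * by apply: measurable_funeM; exact/measurable_EFinP.
    * exact/measurable_EFinP.
    * move=> y _; rewrite -EFinM lee_fin mulrCA ler_wpM2l ?gnu_ge0//.
      exact: wint_inc_ge.
  + exact/measurable_EFinP.
  + move=> y _; rewrite lee_fin mulr_ge0 ?gnu_ge0//.
    exact: (wint_ge0 _ q_ge0 (o0 (u - y))).
- rewrite EFinM (wint_inc_convol_c u hle0) -ge0_integralZl//.
  + apply: ge0_le_integral => //.
    * move=> y _; rewrite lee_fin mulr_ge0 ?gnu_ge0//.
      exact: wint_inc_ge0.
    * exact/measurable_EFinP.
    * by apply: measurable_funeM; exact/measurable_EFinP.
    * move=> y _; rewrite -EFinM lee_fin mulrCA ler_wpM2l ?gnu_ge0//.
      exact: wint_inc_le.
  + exact/measurable_EFinP.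
  + move=> y _; rewrite lee_fin mulr_ge0 ?gnu_ge0//.
    exact: (wint_ge0 _ q_ge0 (c0 (u - y))).
Qed.

Let wint_inc_cst h u v : 0 < h -> wint (inc h u) = wint (inc h v).
Proof.
move=> h0; have hle0 := ltW h0; have g0 := gker_gt0 c 0.
have gle0 := ltW g0.
have mnu := measurable_gnu c.
have [B hB] := cwin_bound hle0.
(* Since [gnu] has mass [gker 0], [rho] is a probability density for which the bounded smoothed mass
   is harmonic. *)
pose rho y := (gker 0)^-1 * gnu y.
have mrho : measurable_fun [set: R] rho by exact: measurable_funM.
have rho0 y : 0 <= rho y by rewrite mulr_ge0 ?gnu_ge0// invr_ge0.
have rhoZ (f : R -> R) : measurable_fun [set: R] f -> (forall y, 0 <= f y) ->
    (\int[mu]_y (rho y * f y)%:E =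
     (gker 0)^-1%:E * \int[mu]_y (gnu y * f y)%:E)%E.
  move=> mf f0; rewrite -ge0_integralZl//.
  - by apply: eq_integral => y _; rewrite -EFinM mulrA.
  - by apply/measurable_EFinP; exact: measurable_funM.
  - by move=> y _; rewrite lee_fin mulr_ge0 ?gnu_ge0.
  - by rewrite lee_fin invr_ge0.
have rho1 : (\int[mu]_y (rho y)%:E = 1)%E.
  have := rhoZ (fun=> 1) (measurable_cst _) (fun=> ler01).
  under eq_integral do rewrite mulr1.
  move=> ->; under eq_integral do rewrite mulr1.
  by rewrite integral_gnuT -EFinM mulVf// gt_eqF.
have rhok M : exists2 k, 0 < k & forall y, 1 <= y <= M -> k <= rho y.
  have [k k0 kle] := gnu_lower c M; exists ((gker 0)^-1 * k).
    by rewrite mulr_gt0// invr_gt0.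
  by move=> y /kle ky; rewrite ler_wpM2l// invr_ge0.
apply: (@convol_harmonic_cst _ rho (fun u => wint (inc h u)) (gker 0 * B)
  mrho rho0 rho1 rhok) => [|{}u|{}u].
- exact: measurable_wint_inc.
- rewrite wint_inc_ge0//=; apply: (le_trans (wint_inc_le u hle0)).
  by rewrite ler_wpM2l//; case: (hB u).
- rewrite (rhoZ (fun y => wint (inc h (u - y)))) -?wint_inc_convol//.
  + by rewrite -EFinM mulKf// gt_eqF.
  + exact: (@msub (fun v => wint (inc h v)) u (measurable_wint_inc hle0)).
  + by move=> y; apply: wint_inc_ge0.
Qed.

(** * Linearity in the window length and passage to half-open intervals *)

Let inc_split s t u x : inc (s + t) u x = inc s u x + inc t (u + s) x.
Proof. by rewrite /inc (addrA u) [RHS]addrC addrA subrK. Qed.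

Let wint_incD s t : 0 <= s -> 0 <= t ->
  wint (inc (s + t) 0) = wint (inc s 0) + wint (inc t 0).
Proof.
move=> s0 t0; rewrite (eq_wint _ _ (inc_split s t 0)).
rewrite (wintD (inc_int 0 s0) (inc_int (0 + s) t0)); congr (_ + _).
(* Translation invariance is available for positive lengths only; for [t = 0] both increments
   vanish. *)
move: t0; rewrite le_eqVlt => /predU1P[<-|t0]; last exact: wint_inc_cst.
by apply: eq_wint => x; rewrite /inc !addr0 !subrr.
Qed.

Let wint_inc_linear h u : 0 < h -> wint (inc h u) = wint (inc 1 0) * h.
Proof.
move=> h0; rewrite (wint_inc_cst u 0 h0).
apply: (@additive_ge0_linear _ (fun t => wint (inc t 0))); last exact: ltW.
  exact: wint_incD.
by move=> s s0; exact: wint_inc_ge0.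
Qed.

(** The smoothed mass is linear in the length, and it separates open from closed window masses. The
    interval []r, s]] is enclosed in a slightly longer open window and contains a slightly shorter
    closed one. *)
Lemma gaussian_balance_lebesgue : exists2 C, 0 <= C & forall r s, r <= s ->
  wintegrable (fun x => (r < x <= s)%R%:R) /\
  wint (fun x => (r < x <= s)%R%:R) = C * (s - r).
Proof.
have g0 := gker_gt0 c 0.
pose C := wint (inc 1 0) / gker 0.
have C0 : 0 <= C by rewrite divr_ge0 ?wint_inc_ge0// ltW.
have CE h : C * h = wint (inc 1 0) * h / gker 0 by rewrite mulrAC.
have owinC h u : 0 < h -> wint (owin h u) <= C * h.
  move=> h0; rewrite CE ler_pdivlMr// mulrC -(wint_inc_linear u h0).
  exact: wint_inc_ge.
have cwinC h u : 0 < h -> C * h <= wint (cwin h u).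
  move=> h0; rewrite CE ler_pdivrMr// [leRHS]mulrC -(wint_inc_linear u h0).
  exact: wint_inc_le (ltW h0).
exists C => // r s rs.
have le1 e x : 0 < e -> (r < x <= s)%R%:R <= owin (s - r + e) r x.
  move=> e0; rewrite /owin ler_nat.
  have [/andP[rx xs]|_] := boolP (r < x <= s); last by [].
  by rewrite lt0b; apply/andP; split => //; lra.
have sr0 e : 0 < e -> 0 < s - r + e by lra.
have ioc : wintegrable (fun x => (r < x <= s)%R%:R).
  apply: (le_wintegrable mq _ _ (owin_int r (ltW (sr0 1 ltr01)))).
    apply: measurable_natrb; apply: measurable_and.
      exact: measurable_fun_ltr.
    exact: measurable_fun_ler.
  by move=> x; rewrite ger0_norm// le1.
split => //; apply/eqP; rewrite eq_le; apply/andP; split.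
  apply/ler_addgt0Pl => e e0.
  have d0 : 0 < e / (C + 1) by rewrite divr_gt0// ltr_wpDl.
  apply: (le_trans (le_wint q_ge0 ioc (owin_int r (ltW (sr0 _ d0))) (le1 _ ^~ d0))).
  apply: (le_trans (owinC _ r (sr0 _ d0))).
  rewrite mulrDr addrC lerD2r mulrCA ger_pMr// ler_pdivrMr ?mul1r ?lerDl//.
  exact: ltr_wpDl.
apply/ler_addgt0Pl => e e0.
have d0 : 0 < e / (C + 1) by rewrite divr_gt0// ltr_wpDl.
have Cd : C * (e / (C + 1)) <= e.
  rewrite mulrCA ger_pMr// ler_pdivrMr ?mul1r ?lerDl//.
  exact: ltr_wpDl.
(* If the interval is too short to contain the closed window, then [C * (s - r)] is already at most
   [e]. *)
have [sd|sd] := leP (s - r) (e / (C + 1)).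
  apply: (@le_trans _ _ (C * (e / (C + 1)))); first exact: ler_wpM2l.
  by apply: (le_trans Cd); rewrite lerDl; apply: wint_ge0.
have d1 : 0 < s - r - e / (C + 1) by rewrite subr_gt0.
rewrite -lerBlDl; apply: (@le_trans _ _ (C * (s - r - e / (C + 1)))).
  by rewrite (mulrBr C (s - r)) lerD2l lerN2.
apply: (le_trans (cwinC _ (r + e / (C + 1)) d1)).
apply: (le_wint q_ge0 (cwin_int _ (ltW d1)) ioc) => x.
rewrite /cwin ler_nat; set d := e / (C + 1) in d0 *.
have [/andP[rx xs]|_] := boolP (r + d <= x <= _); last by [].
by rewrite lt0b; apply/andP; split; lra.
Qed.

End gaussian_balance.

(** * Identification of the normal distribution *)

Section identification.
Context {R : realType}.
Local Notation mu := (@lebesgue_measure R).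

Lemma is_derive_quadratic (F : R -> R) (x d K : R) :
  (forall y, `|F y - F x - d * (y - x)| <= K * (y - x) ^+ 2) ->
  is_derive x 1 F d.
Proof.
move=> FK.
have K0 : 0 <= K.
  have := FK (x + 1); rewrite (_ : x + 1 - x = 1) ?expr1n ?mulr1; last by ring.
  exact: le_trans.
have cv : h^-1 *: ((F \o shift x) (h *: 1) - F x) @[h --> 0^'] --> d.
  apply/cvgrPdist_le => e e0; near=> h.
  have h0 : h != 0 by near: h; exact: nbhs_dnbhs_neq.
  rewrite /= /GRing.scale/= mulr1.
  have := FK (h + x); rewrite addrK.
  have -> : d - h^-1 * (F (h + x) - F x) = - (h^-1 * (F (h + x) - F x - d * h)).
    by field.
  rewrite normrN normrM normfV => le.
  rewrite mulrC ler_pdivrMr ?normr_gt0//; apply: (le_trans le).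
  rewrite -real_normK ?num_real// expr2 mulrA ler_wpM2r//.
  apply: (@le_trans _ _ (K * (e / (K + 1)))).
    rewrite ler_wpM2l//; near: h; apply: dnbhs0_le.
    by rewrite divr_gt0// ltr_wpDl.
  rewrite mulrCA ger_pMr// ler_pdivrMr ?mul1r ?lerDl//.
  exact: ltr_wpDl.
apply: DeriveDef; first by apply/cvg_ex; exists d.
exact/cvg_lim.
Unshelve. all: by end_near. Qed.

(** By the mean value theorem: the derivative of the standard density is [- z * normal_pdf 0 1 z],
    and the absolute value of [z] is at most [1 + z ^+ 2 / 2 <= expR (z ^+ 2 / 2)]. *)
Lemma normal_pdf1_lipschitz (m x y : R) :
  `|normal_pdf m 1 y - normal_pdf m 1 x| <= normal_peak 1 * `|y - x|.
Proof.
have -> : normal_pdf m 1 = (fun z : R => normal_pdf 0 1 (z - m)).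
  by apply/funext => z; rewrite !normal_pdf1E subr0.
have dp := is_derive_comp_subr m (@is_derive_std_normal_pdf R).
have bnd (z : R) : `|- z * normal_pdf 0 1 z| <= normal_peak 1.
  rewrite normrM normrN (ger0_norm (normal_pdf_ge0 _ _ _)) normal_pdf1E subr0.
  rewrite mulrCA ger_pMr ?normal_peak_gt0//.
  rewrite mulNr expRN ler_pdivrMr ?expR_gt0// mul1r.
  apply: le_trans (expR_ge1Dx _); rewrite -real_normK ?num_real//.
  by have := sqr_ge0 (`|z| - 1); nra.
wlog xy : x y / x <= y.
  move=> H; have [/H//|/ltW/H yx] := leP x y.
  by rewrite distrC (distrC y).
have cp : continuous (fun z : R => normal_pdf 0 1 (z - m)).
  exact: is_derive_continuous dp.
have [z _ ->] := MVT_segment xy (fun z _ => dp z) (continuous_subspaceT cp).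
by rewrite normrM ler_wpM2r.
Qed.

(** Between [x] and [y] the function [p] stays within L times the distance of [p x], so the sandwich
    leaves a remainder of at most [L * C * (y - x) ^+ 2]. *)
Lemma integral_cdf_quadratic (p F : R -> R) (C L : R) : 0 <= C ->
  (forall x y, `|p y - p x| <= L * `|y - x|) ->
  (forall r s lo hi, r <= s -> (forall x, r < x <= s -> lo <= p x <= hi) ->
    lo * (C * (s - r)) <= F s - F r <= hi * (C * (s - r))) ->
  forall x : R, is_derive x 1 F (C * p x).
Proof.
move=> C0 pL Fp x; apply: (@is_derive_quadratic _ _ _ (L * C)) => y.
have L0 : 0 <= L by have := pL 0 1; rewrite subr0 normr1 mulr1; apply: le_trans.
have pLe (z w h : R) : `|w - z| <= h -> p z - L * h <= p w <= p z + L * h.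
  move=> wz; have := le_trans (pL z w) (ler_wpM2l L0 wz).
  by rewrite ler_norml => /andP[? ?]; apply/andP; split; lra.
have [xy|/ltW yx] := leP x y.
  have H z : x < z <= y -> p x - L * (y - x) <= p z <= p x + L * (y - x).
    by move=> /andP[xz zy]; apply: pLe; rewrite ger0_norm; lra.
  have /andP[lo hi] := Fp _ _ _ _ xy H.
  by rewrite ler_norml; apply/andP; split; lra.
have H z : y < z <= x -> p x - L * (x - y) <= p z <= p x + L * (x - y).
  by move=> /andP[yz zx]; apply: pLe; rewrite ler0_norm; lra.
have /andP[lo hi] := Fp _ _ _ _ yx H.
by rewrite ler_norml; apply/andP; split; lra.
Qed.

(** The distribution function of [P] has derivative [C * normal_pdf m 1], so it differs by a
    constant from [C] times that of N(m, 1). The measures then agree on half-open intervals, hence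
    everywhere, and total mass forces [C = 1]. *)
Lemma probability_eq_normal (P : {measure set (measurableTypeR R) -> \bar R})
    (m C : R) : P setT = 1%E -> 0 <= C ->
  (forall r s lo hi : R, r <= s ->
    (forall x, r < x <= s -> lo <= normal_pdf m 1 x <= hi) ->
    lo * (C * (s - r)) <= fine (P `]r, s]%classic) <= hi * (C * (s - r))) ->
  forall A, measurable A -> P A = normal_prob m 1 A.
Proof.
move=> PT C0 PC.
pose N := normal_prob m 1 : {measure set (measurableTypeR R) -> \bar R}.
have Pfin (Q : {measure set (measurableTypeR R) -> \bar R})
    (A : set (measurableTypeR R)) : Q setT = 1%E -> measurable A -> Q A \is a fin_num.
  move=> QT mA; rewrite ge0_fin_numE// (@le_lt_trans _ _ 1%E) ?ltry//.
  by rewrite -QT le_measure ?inE.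
have NT : N setT = 1%E by exact: (@probability_setT _ _ _ (normal_prob m 1)).
pose cdf (Q : {measure set (measurableTypeR R) -> \bar R}) (x : R) := fine (Q `]-oo, x]%classic).
have cdfB (Q : {measure set (measurableTypeR R) -> \bar R}) (r s : R) :
    Q setT = 1%E -> r <= s -> cdf Q s - cdf Q r = fine (Q `]r, s]%classic).
  move=> QT rs; apply/eqP; rewrite subr_eq addrC eq_sym; apply/eqP.
  rewrite /cdf -fineD ?Pfin//.
  rewrite -measureU//; first by rewrite -itv_bndbnd_setU// ?bnd_simp.
  apply/seteqP; split => // x [/=]; rewrite !in_itv/= => xr /andP[rx _].
  by move: rx; rewrite ltNge xr.
have dP (x : R) : is_derive x 1 (cdf P) (C * normal_pdf m 1 x).
  apply: (@integral_cdf_quadratic (normal_pdf m 1) _ _ (normal_peak 1)) => //.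
    exact: normal_pdf1_lipschitz.
  by move=> r s lo hi rs H; rewrite cdfB//; exact: PC.
have dN (x : R) : is_derive x 1 (cdf N) (normal_pdf m 1 x).
  have [dN <-] : derivable (cdf N) x 1 /\ derive1 (cdf N) x = normal_pdf m 1 x.
    apply: (@continuous_FTC1 R (normal_pdf m 1) -oo%O x (x + 1)).
    - by rewrite ltrDl.
    - exact: integrableS (integrable_normal_pdf m 1).
    - exact: ltNyr.
    - exact: continuous_normal_pdf.
  by rewrite derive1E; exact: derivableP.
pose D x := cdf P x - C * cdf N x.
have D0 r s : D r = D s.
  apply: is_derive_0_is_cst => x; have d1 := dP x; have d2 := dN x.
  by apply: is_derive_eq; rewrite /GRing.scale/= subrr.
pose CN : {measure set (measurableTypeR R) -> \bar R} := mscale (NngNum C0) N.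
have PN A : measurable A -> P A = CN A.
  apply: (@measure_unique _ R (measurableTypeR R) (@ocitv R)
    (fun n => `](- n%:R : R), n%:R]%classic) _ _ _ _ P CN).
  - by [].
  - exact: ocitvI.
  - by move=> n; exact: is_ocitv.
  - apply/seteqP; split => // x _; exists (Num.bound `|x|) => //=.
    rewrite in_itv/=; have := archi_boundP (normr_ge0 x).
    by rewrite ltr_norml => /andP[-> /ltW].
  - move=> _ [[r s] _ <-]/=.
    have [rs|sr] := leP r s; last first.
      by rewrite set_itv_ge ?measure0// bnd_simp -leNgt ltW.
    rewrite /CN/= /mscale/= -(fineK (Pfin P `]r, s]%classic PT _))// -(fineK (Pfin N `]r, s]%classic NT _))//.
    rewrite -EFinM; congr EFin; rewrite -!cdfB//.
    by have := D0 r s; rewrite /D; lra.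
  - by move=> n; rewrite -ge0_fin_numE// Pfin.
have C1 : C = 1.
  have := PN setT measurableT; rewrite PT /CN/= /mscale/= NT mule1 => -[].
  by move=> ->.
by move=> A mA; rewrite PN// /CN/= /mscale/= C1 mul1e.
Qed.

End identification.

(** Completing the square; the first factor is the inverse of the moment generating function of N(m,
    1) at [t]. *)
Lemma normal_pdf1_tilt {R : realType} (m t x : R) :
  normal_pdf (m + t) 1 x =
  expR (- (m * t + t ^+ 2 / 2)) * (expR (t * x) * normal_pdf m 1 x).
Proof.
rewrite !normal_pdf1E [RHS]mulrA [RHS]mulrCA -!expRD; congr (_ * expR _).
by field.
Qed.

(** With weight [q = 1 / normal_pdf m 1], the quantile hypothesis at [t = u - b] becomes the balance
    condition at [u]. The weighted measure is then a multiple of the Lebesgue measure, and tilting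
    moves the mean to [m + t]. *)
Lemma nef_normal {R : realType} (P0 : probability (measurableTypeR R) R)
    (alpha b : R)
    (mgf_fin : forall t : R, (mgf P0 t < +oo)%E)
    (alpha01 : 0 < alpha < 1)
    (quantile : forall t : R,
      (\int[P0]_(x in `]-oo, (b + t)%R[) (expR (t * x))%:E
         <= alpha%:E * mgf P0 t
         <= \int[P0]_(x in `]-oo, (b + t)%R]) (expR (t * x))%:E)%E)
    (t : R) (A : set (measurableTypeR R)) :
  measurable A ->
  nef P0 t A = normal_prob (b - std_normal_quantile alpha + t) 1 A.
Proof.
set c := std_normal_quantile alpha; set m := b - c.
have alphaE : gtail c 0 = alpha by rewrite /gtail subr0 std_normal_quantileK.
pose q x := (normal_pdf m 1 x)^-1.
have p0 x : normal_pdf m 1 x != 0 by rewrite gt_eqF ?normal_pdf1_gt0.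
have q_ge0 x : 0 <= q x by rewrite invr_ge0 normal_pdf_ge0.
have mq : measurable_fun [set: R] q.
  apply: continuous_measurable_fun => x; apply: cvgV => //.
  exact: continuous_normal_pdf.
have mexp (v : R) : measurable_fun [set: measurableTypeR R]
    (fun x : measurableTypeR R => (expR (v * x))%:E).
  by apply/measurable_EFinP; exact: measurableT_comp.
pose kap v := expR (- (m * v + v ^+ 2 / 2)).
have kap0 v : 0 <= kap v by exact: expR_ge0.
have qE u x : q x * gker c (u - x) = kap (u - b) * expR ((u - b) * x).
  have -> : gker c (u - x) = normal_pdf (m + (u - b)) 1 x.
    by rewrite /gker !normal_pdf1E subr0 (_ : c - (u - x) = x - (m + (u - b)))// /m; ring.
  by rewrite normal_pdf1_tilt mulrC mulrA mulfK.
have mgfK v : (fine (mgf P0 v))%:E = mgf P0 v.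
  by rewrite fineK// ge0_fin_numE ?mgf_fin// ltW// mgf_gt0.
have Ig (u : R) (D : set R) (w : R -> bool) : measurable D ->
    (forall x, (x \in D) = w x) ->
    (\int[P0]_x (q x * ((w x)%:R * gker c (u - x)))%:E =
     (kap (u - b))%:E * \int[P0]_(x in D) (expR ((u - b) * x))%:E)%E.
  move=> mD wD; rewrite -ge0_integralZl//.
  - rewrite [RHS]integral_mkcond; apply: eq_integral => x _.
    rewrite patchE wD mulrCA qE; case: (w x); last by rewrite mul0r.
    by rewrite mul1r EFinM.
  - exact/measurable_funTS.
  - by rewrite lee_fin.
have IgT (u : R) : (\int[P0]_x (q x * gker c (u - x))%:E =
    (kap (u - b) * fine (mgf P0 (u - b)))%:E)%E.
  rewrite EFinM mgfK mgfE -(@Ig _ setT xpredT)//.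
    by apply: eq_integral => x _; rewrite mul1r.
  by move=> x; exact: mem_set.
have mgk u : measurable_fun [set: R] (fun x => gker c (u - x)).
  by apply: (measurableT_comp (measurable_gker c)); exact: measurable_funB.
have gker_int u : wintegrable P0 q (fun x => gker c (u - x)).
  apply: (ge0_wintegrable mq q_ge0 (mgk u)) => [x|]; first exact: gker_ge0.
  by rewrite IgT ltry.
have wgker u : wint P0 q (fun x => gker c (u - x)) =
    kap (u - b) * fine (mgf P0 (u - b)).
  by apply/EFin_inj; rewrite (EFin_wint (gker_int u)) IgT.
have gker_loc r s : exists C, forall u, r <= u <= s ->
    wint P0 q (fun x => gker c (u - x)) <= C.
  (* Completing the square bounds [kap] by [expR (m ^+ 2 / 2)], and for [v] between [r - b] and
     [s - b] the exponential [expR (v * x)] is at most the sum of those at the two ends. *)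
  exists (expR (m ^+ 2 / 2) * (fine (mgf P0 (r - b)) + fine (mgf P0 (s - b)))).
  move=> u /andP[ru us]; rewrite wgker ler_pM//.
  - by rewrite fine_ge0// ltW// mgf_gt0.
  - by rewrite ler_expR; have := sqr_ge0 (m + (u - b)); nra.
  - rewrite -lee_fin EFinD !mgfK !mgfE -ge0_integralD//.
    apply: ge0_le_integral => //.
    + by apply: emeasurable_funD.
    + move=> x _; rewrite -EFinD lee_fin.
      have [x0|x0] := leP 0 x.
        rewrite (@le_trans _ _ (expR ((s - b) * x)))// ?lerDr ?expR_ge0//.
        by rewrite ler_expR ler_wpM2r//; lra.
      rewrite (@le_trans _ _ (expR ((r - b) * x)))// ?lerDl ?expR_ge0//.
      by rewrite ler_expR ler_wnM2r//; lra.
have mlt u : measurable_fun [set: R] (fun x => (x < u)%R%:R : R).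
  by apply: measurable_natrb; exact: measurable_fun_ltr.
have mle u : measurable_fun [set: R] (fun x => (x <= u)%R%:R : R).
  by apply: measurable_natrb; exact: measurable_fun_ler.
have cutint (w : R -> bool) u : measurable_fun [set: R] (fun x => (w x)%:R : R) ->
    wintegrable P0 q (fun x => (w x)%:R * gker c (u - x)).
  move=> mw; apply: (le_wintegrable mq _ _ (gker_int u)).
    exact: measurable_funM.
  move=> x; rewrite ger0_norm ?mulr_ge0 ?gker_ge0//.
  by case: (w x); rewrite ?mul1r ?mul0r ?gker_ge0.
have bE u : b + (u - b) = u by ring.
have balance_lt u : wint P0 q (fun x => (x < u)%R%:R * gker c (u - x)) <=
    gtail c 0 * wint P0 q (fun x => gker c (u - x)).
  rewrite -lee_fin EFinM (EFin_wint (cutint _ u (mlt u))) (EFin_wint (gker_int u)).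
  rewrite (@Ig _ `]-oo, u[%classic (fun x => x < u))//; last first.
    by move=> x; rewrite mem_setE in_itv.
  rewrite IgT EFinM mgfK muleCA alphaE lee_wpmul2l ?lee_fin//.
  by have /andP[] := quantile (u - b); rewrite bE.
have balance_le u : gtail c 0 * wint P0 q (fun x => gker c (u - x)) <=
    wint P0 q (fun x => (x <= u)%R%:R * gker c (u - x)).
  rewrite -lee_fin EFinM (EFin_wint (cutint _ u (mle u))) (EFin_wint (gker_int u)).
  rewrite (@Ig _ `]-oo, u]%classic (fun x => x <= u))//; last first.
    by move=> x; rewrite mem_setE in_itv.
  rewrite IgT EFinM mgfK muleCA alphaE lee_wpmul2l ?lee_fin//.
  by have /andP[] := quantile (u - b); rewrite bE.
have [C C0 CE] := gaussian_balance_lebesgue mq q_ge0 gker_int gker_loc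
  balance_lt balance_le.
have M0 : 0 < fine (mgf P0 t) by rewrite fine_gt0// mgf_gt0 mgf_fin.
(* By the tilting identity, [a * normal_pdf (m + t) 1] is the density of [nef P0 t] with respect to
   the weighted measure. *)
pose a := (kap t * fine (mgf P0 t))^-1.
have a0 : 0 <= a by rewrite invr_ge0 mulr_ge0// ltW.
apply: (@probability_eq_normal _ (nef P0 t) (m + t) (a * C)).
- exact: nef_setT.
- exact: mulr_ge0.
move=> r s lo hi rs lohi; have [ioc eoc] := CE r s rs.
pose f x := (r < x <= s)%R%:R * (a * normal_pdf (m + t) 1 x).
have f0 x : 0 <= f x by rewrite !mulr_ge0 ?normal_pdf_ge0.
have fi : wintegrable P0 q f.
  apply: (le_wintegrable mq _ _ (wintegrableZ (a * normal_peak 1) ioc)).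
    apply: measurable_funM; last first.
      by apply: measurable_funM => //; exact: measurable_normal_pdf.
    apply: measurable_natrb; apply: measurable_and.
      exact: measurable_fun_ltr.
    exact: measurable_fun_ler.
  move=> x; rewrite ger0_norm// /f mulrC ler_wpM2r// ler_wpM2l//.
  exact: normal_pdf_ub.
have -> : fine (nef P0 t `]r, s]%classic) = wint P0 q f.
  rewrite /wint /Rintegral /nef; congr fine; rewrite [LHS]integral_mkcond; apply: eq_integral => x _.
  rewrite patchE mem_setE in_itv /f mulrCA.
  case: (r < x <= s); last by rewrite mul0r.
  rewrite mul1r normal_pdf1_tilt /q /a -/(kap t); congr EFin.
  field.
  by rewrite p0 (gt_eqF M0) gt_eqF// expR_gt0.
have bnd k : k * (a * C * (s - r)) = wint P0 q (fun x => (k * a) * (r < x <= s)%R%:R).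
  by rewrite (wintZ (k * a) ioc) eoc; ring.
apply/andP; split; rewrite bnd; apply: (le_wint q_ge0) => //.
- exact: wintegrableZ.
- move=> x; rewrite /f; have [/lohi/andP[lx _]|_] := boolP (r < x <= s).
    by rewrite mulr1 mul1r (mulrC lo) ler_wpM2l.
  by rewrite mulr0 mul0r.
- exact: wintegrableZ.
- move=> x; rewrite /f; have [/lohi/andP[_ xh]|_] := boolP (r < x <= s).
    by rewrite mulr1 mul1r (mulrC hi) ler_wpM2l.
  by rewrite mulr0 mul0r.
Qed.

Theorem theorem1 (R : realType) (P0 : probability (measurableTypeR R) R)
    (alpha b : R)
    (mgf_fin : forall t : R, (mgf P0 t < +oo)%E)
    (alpha01 : 0 < alpha < 1)
    (quantile : forall t : R,
      (\int[P0]_(x in `]-oo, (b + t)%R[) (expR (t * x))%:E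
         <= alpha%:E * mgf P0 t
         <= \int[P0]_(x in `]-oo, (b + t)%R]) (expR (t * x))%:E)%E) :
  let mstar := b - std_normal_quantile alpha in
  (forall A : set (measurableTypeR R), measurable A ->
     P0 A = normal_prob mstar 1 A) /\
  (forall (t : R) (A : set (measurableTypeR R)), measurable A ->
     nef P0 t A = normal_prob (mstar + t) 1 A).
Proof.
move=> mstar; have nefE := nef_normal mgf_fin alpha01 quantile.
split; last exact: nefE.
(* [P0] is the member [t = 0] of its family, as the moment generating function at 0 is 1. *)
move=> A mA; rewrite -[mstar]addr0 -nefE// /nef mgfE.
have -> : (\int[P0]_x (expR (0 * x))%:E = 1)%E.
  under eq_integral do rewrite mul0r expR0.
  by rewrite integral_cst// mul1e; exact: probability_setT.
under eq_integral do rewrite mul0r expR0 divr1.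
by rewrite integral_cst// mul1e.
Qed.
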